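(* Let $f(z)=\sum_{n=0}^{\infty}a_n z^n$ be an entire function with $a_0\cdot a_n>0$ for all $n\in\mathbb{N}_0$, whose order $\rho(f)$ satisfies $0\le\rho(f)<1$, and which has only negative roots $\{-\lambda_n\}_{n\in\mathbb{N}}$ (so $\lambda_n>0$ for all $n$). Then for all $k,m\in\mathbb{N}_0$ the real function $$G_k^{(m)}(x)=\left(-\frac{1}{x}\right)^{m}\frac{d^{k}}{dx^{k}}\left(x^{k+m}\frac{d^{m}}{dx^{m}}\left(\frac{f'(x)}{f(x)}\right)\right)$$ is completely monotonic on $(0,\infty)$. Moreover, for each $m\in\mathbb{N}_0$ these functions can be computed via the recurrence $$G_0^{(m)}(x)=(-1)^m\frac{d^m}{dx^m}\left(\frac{f'(x)}{f(x)}\right),\qquad G_k^{(m)}(x)=(m+k)\,G_{k-1}^{(m)}(x)+x\frac{d}{dx}G_{k-1}^{(m)}(x),\quad k\in\mathbb{N},\ x>0.$$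
   Context: Notation: $\mathbb{N}=\{1,2,3,\dots\}$ and $\mathbb{N}_0=\{0,1,2,\dots\}$. The order of an entire function $f(z)=\sum_{n\ge0}a_nz^n$ is $$\rho(f)=\limsup_{r\to\infty}\frac{\log\left(\log\left\{\sup\{|f(z)|:|z|\le r\}\right\}\right)}{\log r}=-\limsup_{n\to\infty}\frac{n\log n}{\log|a_n|}.$$ Roots are listed with multiplicity; since $\rho(f)<1$, $f$ has genus $0$ and $\frac{f(z)}{f(0)}=\prod_{n=1}^\infty\left(1+\frac{z}{\lambda_n}\right)$ with $\sum_{n=1}^{\infty}\frac1{|\lambda_n|}<\infty$. A function $g:(0,\infty)\to\mathbb{R}$ is completely monotonic on $(0,\infty)$ if $g\in C^\infty(0,\infty)$ and $(-1)^j g^{(j)}(x)\ge 0$ for all $j\in\mathbb{N}_0$ and $x>0$. *)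

(* Defs.v *)
From Stdlib Require Import Reals List.
From Coquelicot Require Import Coquelicot.
Open Scope R_scope.

Definition entire_series (a : nat -> C) (f : C -> C) : Prop :=
  forall z : C, is_pseries a z (f z).

Definition is_entire (f : C -> C) : Prop :=
  exists a : nat -> C, entire_series a f.

(* [Lub_Rbar] is finite here as soon as [f] is entire and [0 <= r]. *)
Definition max_modulus (f : C -> C) (r : R) : R :=
  real (Lub_Rbar (fun y => exists z : C, Cmod z <= r /\ y = Cmod (f z))).

Definition limsup_infty (q : R -> R) : Rbar :=
  Rbar_glb (fun s => exists r0 : R,
    s = Lub_Rbar (fun y => exists r : R, r0 < r /\ y = q r)).

(* For a nonconstant entire function both outer logarithms have arguments
   greater than 1 for large [r], so the values of [ln] and [/] outside their
   natural domains do not affect the limit superior. *)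
Definition order (f : C -> C) : Rbar :=
  limsup_infty (fun r => ln (ln (max_modulus f r)) / ln r).

(* Multiplicity 0 means that [z] is not a root of [f]. *)
Definition has_multiplicity (f : C -> C) (z : C) (m : nat) : Prop :=
  exists g : C -> C, is_entire g /\ g z <> RtoC 0 /\
    forall w : C, f w = Cmult (Cpow (Cminus w z) m) (g w).

(* The sequence [mu] enumerates exactly the roots of [f], each occurring as
   many times as its multiplicity ([l] collects the indices where [mu] equals
   [z]). *)
Definition lists_roots (f : C -> C) (mu : nat -> C) : Prop :=
  forall z : C, exists l : list nat,
    NoDup l /\ (forall n : nat, In n l <-> mu n = z) /\
    has_multiplicity f z (length l).

(* For the functions considered here [f] is real on the real axis, so that
   this is [f] itself restricted to the reals. *)
Definition on_reals (f : C -> C) (x : R) : R := Re (f (RtoC x)).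

Definition log_derivative (h : R -> R) (x : R) : R := Derive h x / h x.

Definition G (f : C -> C) (m k : nat) (x : R) : R :=
  (- (1 / x)) ^ m *
  Derive_n
    (fun t => t ^ (k + m) * Derive_n (log_derivative (on_reals f)) m t) k x.

Definition completely_monotonic (g : R -> R) : Prop :=
  forall (j : nat) (x : R), 0 < x ->
    ex_derive_n g j x /\ 0 <= (-1) ^ j * Derive_n g j x.

(* Main.v *)
Require Import Defs.
From mathcomp Require all_boot all_algebra Rstruct complex.
From Stdlib Require Import Reals List Lra Lia Classical IndefiniteDescription
  Factorial.
From Coquelicot Require Import Coquelicot.
Open Scope R_scope.

(** Everything follows from the partial fraction expansion
    [f'(x)/f(x) = sum_n 1/(x + lam n)] on the positive half-line.  Indeed,
    differentiating termwise and using [D^k (t * y) = t * D^k y + k * D^(k-1) y]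
    one finds by induction on [k]
    [G f m k x = (k+m)! * sum_n (lam n)^k / (x + lam n)^(k+m+1)]
    ([G_closed_form]).  Every summand is completely monotonic, hence so is the
    sum, and the recurrence reduces to the identity
    [lam^k (x + lam) - x lam^k = lam^(k+1)] ([stieltjes_sum_shift]).

    The expansion is the logarithmic derivative of the Hadamard product
    [f(x)/f(0) = prod_n (1 + x/lam n)], and most of the work goes into proving
    this product formula from power series alone, without contour integrals.
    Write [F = f/f(0)].  For a radius [R], the roots of modulus at most [R] are
    finitely many ([finitely_many_roots]) and can be divided out one by one:
    [F = T * H], where [T] is the product of the corresponding factors and [H]
    is entire, equal to 1 at 0 and zero-free on the disc of radius [R]
    ([factor_out_roots], [cofactor_zero_free]).  On the circle of radius [2R] one
    has [|T| >= 1], so that [|H|] is at most the maximum [B] of [|F|] there.  The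
    key estimate ([zero_free_log_bound]) is that such an [H] satisfies
    [|ln |H(x)|| <= 4 ln(2B) x/R] for [x <= R/2].  Since the order of [f] is less
    than one, [ln B = o(R)], hence [H(x)] tends to 1 and [T(x)] to [F(x)]
    ([hadamard_product_log]).

    The key estimate is a Borel-Caratheodory inequality.  Instead of the
    logarithm of [H], whose analyticity would require Cauchy's theorem, one uses
    the Taylor polynomials of [H]: for large degree they are zero-free on the
    disc as well, and by the fundamental theorem of algebra they are products of
    factors [1 - v z] with [|v| R < 1], whose logarithm has an explicit power
    series ([log_series_truncation]).  The coefficients of the sum of these
    series are bounded by the maximum of its real part
    ([polynomial_borel_caratheodory]); the mean values over circles that this
    requires are averages over roots of unity, exact for polynomials
    ([circle_sum_coef], [circle_sum_conj]). *)

(** * Finite sums and entire power series *)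

(** The generic finite sums at the types of complex and real numbers, so that
    terms keep [Cplus] and [Rplus] instead of the operations of an abstract
    monoid and stay within the reach of [ring]. *)
Definition csum (u : nat -> C) (n : nat) : C := sum_n u n.
Definition rsum (u : nat -> R) (n : nat) : R := sum_n u n.

Lemma csum_0 u : csum u 0 = u 0%nat.
Proof. apply sum_O. Qed.

Lemma csum_S u n : csum u (S n) = (csum u n + u (S n))%C.
Proof. apply (sum_Sn (G := C_AbelianGroup)). Qed.

Lemma rsum_0 u : rsum u 0 = u 0%nat.
Proof. apply sum_O. Qed.

Lemma rsum_S u n : rsum u (S n) = rsum u n + u (S n).
Proof. apply (sum_Sn (G := R_AbelianGroup)). Qed.

Lemma csum_ext u v n :
  (forall k, (k <= n)%nat -> u k = v k) -> csum u n = csum v n.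
Proof. apply sum_n_ext_loc. Qed.

Lemma csum_scal c u n : csum (fun k => c * u k)%C n = (c * csum u n)%C.
Proof. apply (sum_n_mult_l (K := C_Ring)). Qed.

Lemma csum_plus u v n :
  csum (fun k => u k + v k)%C n = (csum u n + csum v n)%C.
Proof. apply (sum_n_plus (G := C_AbelianGroup)). Qed.

Lemma csum_switch (u : nat -> nat -> C) m n :
  csum (fun i => csum (u i) n) m = csum (fun j => csum (fun i => u i j) m) n.
Proof. apply (sum_n_switch (G := C_AbelianGroup)). Qed.

Lemma Cmod_csum_le u v n :
  (forall k, (k <= n)%nat -> Cmod (u k) <= v k) -> Cmod (csum u n) <= rsum v n.
Proof.
induction n as [|n IH]; intros H.
- rewrite csum_0, rsum_0; now apply H.
- rewrite csum_S, rsum_S.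
  eapply Rle_trans; [apply Cmod_triangle|].
  apply Rplus_le_compat; [apply IH; intros; apply H; lia | now apply H].
Qed.

Lemma rsum_const c n : rsum (fun _ => c) n = INR (S n) * c.
Proof. apply sum_n_const. Qed.

Lemma rsum_le u v n :
  (forall k, (k <= n)%nat -> u k <= v k) -> rsum u n <= rsum v n.
Proof.
induction n as [|n IH]; intros H; [rewrite !rsum_0; now apply H|].
rewrite !rsum_S; apply Rplus_le_compat; [apply IH; intros; apply H; lia | now apply H].
Qed.

Lemma rsum_scal c u n : rsum (fun k => c * u k) n = c * rsum u n.
Proof. apply (sum_n_mult_l (K := R_Ring)). Qed.

Lemma Re_csum u n : Re (csum u n) = rsum (fun k => Re (u k)) n.
Proof.
induction n as [|n IH]; [now rewrite csum_0, rsum_0|].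
now rewrite csum_S, rsum_S, <- IH.
Qed.

Definition psum (b : nat -> C) (z : C) (n : nat) : C :=
  csum (fun k => b k * z ^ k)%C n.

Lemma Cseries_iff (u : nat -> C) (l : C) :
  is_series (K := C_AbsRing) (V := C_NormedModule) u l <->
  forall eps, 0 < eps ->
    exists N, forall n, (N <= n)%nat -> Cmod (csum u n - l) < eps.
Proof.
unfold is_series.
rewrite (filterlim_locally_ball_norm (U := C_NormedModule)).
split.
- intros H eps He; destruct (H (mkposreal eps He)) as [N HN].
  exists N; intros n Hn; exact (HN n Hn).
- intros H [eps He]; destruct (H eps He) as [N HN].
  exists N; intros n Hn; exact (HN n Hn).
Qed.

Lemma Rseries_iff (u : nat -> R) (l : R) :
  is_series u l <->
  forall eps, 0 < eps ->
    exists N, forall n, (N <= n)%nat -> Rabs (rsum u n - l) < eps.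
Proof.
unfold is_series.
rewrite (filterlim_locally_ball_norm (U := R_NormedModule)).
split.
- intros H eps He; destruct (H (mkposreal eps He)) as [N HN].
  exists N; intros n Hn; exact (HN n Hn).
- intros H [eps He]; destruct (H eps He) as [N HN].
  exists N; intros n Hn; exact (HN n Hn).
Qed.

(** Unfolds the scalar multiplications hidden in [is_pseries]. *)
Lemma entire_series_iff b h :
  entire_series b h <->
  forall z, is_series (K := C_AbsRing) (V := C_NormedModule)
    (fun k => b k * z ^ k)%C (h z).
Proof.
assert (E : forall z k, scal (K := C_AbsRing) (V := C_NormedModule)
             (pow_n (K := C_AbsRing) z k) (b k) = (b k * z ^ k)%C).
{ intros z k; rewrite (Cmult_comm (b k)).
  reflexivity. }
split; intros H z; specialize (H z).
- eapply is_series_ext; [|exact H]; intros k; apply E.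
- eapply is_series_ext; [|exact H]; intros k; symmetry; apply E.
Qed.

(** Comparison of the remainder of a complex series with that of a majorant;
    applied to a scaled majorant it also shows how fast the remainder
    shrinks. *)
Lemma Cseries_tail_le (u : nat -> C) (v : nat -> R) (l : C) (s : R) n :
  is_series (K := C_AbsRing) (V := C_NormedModule) u l -> is_series v s ->
  (forall k, (n < k)%nat -> Cmod (u k) <= v k) ->
  Cmod (l - csum u n) <= s - rsum v n.
Proof.
intros Hu Hv Huv.
assert (A : forall m, Cmod (csum u (n + m) - csum u n) <= rsum v (n + m) - rsum v n).
{ induction m as [|m IH].
  - rewrite Nat.add_0_r; unfold Cminus; rewrite Cplus_opp_r, Cmod_0; lra.
  - rewrite Nat.add_succ_r, csum_S, rsum_S.
    replace (csum u (n + m) + u (S (n + m)) - csum u n)%C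
      with ((csum u (n + m) - csum u n) + u (S (n + m)))%C by ring.
    eapply Rle_trans; [apply Cmod_triangle|].
    assert (Cmod (u (S (n + m))) <= v (S (n + m))) by (apply Huv; lia).
    lra. }
apply Rnot_lt_le; intros Hlt.
set (eps := (Cmod (l - csum u n) - (s - rsum v n)) / 2).
assert (He : 0 < eps) by (unfold eps; lra).
destruct (proj1 (Cseries_iff u l) Hu eps He) as [N1 H1].
destruct (proj1 (Rseries_iff v s) Hv eps He) as [N2 H2].
specialize (H1 (n + (N1 + N2))%nat ltac:(lia)).
specialize (H2 (n + (N1 + N2))%nat ltac:(lia)).
specialize (A (N1 + N2)%nat).
apply Rabs_def2 in H2.
assert (T : Cmod (l - csum u n) <=
  Cmod (csum u (n + (N1 + N2)) - l) + Cmod (csum u (n + (N1 + N2)) - csum u n)).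
{ rewrite <- (Cmod_opp (csum u (n + (N1 + N2)) - l)).
  replace (l - csum u n)%C with (- (csum u (n + (N1 + N2)) - l) +
    (csum u (n + (N1 + N2)) - csum u n))%C by ring.
  apply Cmod_triangle. }
unfold eps in *; lra.
Qed.

Lemma Cseries_norm_le (u : nat -> C) (v : nat -> R) (l : C) (s : R) :
  is_series (K := C_AbsRing) (V := C_NormedModule) u l -> is_series v s ->
  (forall k, Cmod (u k) <= v k) -> Cmod l <= s.
Proof.
intros Hu Hv Huv.
assert (H := Cseries_tail_le u v l s 0 Hu Hv (fun k _ => Huv k)).
rewrite csum_0, rsum_0 in H.
assert (T := Cmod_triangle (l - u 0%nat) (u 0%nat)).
replace (l - u 0%nat + u 0%nat)%C with l in T by ring.
specialize (Huv 0%nat); lra.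
Qed.

(** The terms of a convergent series tend to zero, hence are bounded. *)
Lemma entire_coef_bounded b h r :
  entire_series b h -> 0 <= r ->
  exists K, forall k, Cmod (b k) * r ^ k <= K.
Proof.
intros H Hr; rewrite entire_series_iff in H.
destruct (proj1 (Cseries_iff _ _) (H (RtoC r)) 1 Rlt_0_1) as [N HN].
assert (T : forall k, (N < k)%nat -> Cmod (b k) * r ^ k <= 2).
{ intros [|k] Hk; [lia|].
  assert (H1 := HN k ltac:(lia)); assert (H2 := HN (S k) ltac:(lia)).
  rewrite csum_S in H2.
  assert (Cmod (b (S k) * RtoC r ^ S k) = Cmod (b (S k)) * r ^ S k).
  { now rewrite Cmod_mult, Cmod_pow, Cmod_R, Rabs_pos_eq. }
  rewrite <- H0.
  match goal with |- Cmod ?X <= _ => replace X with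
    ((csum (fun k => b k * RtoC r ^ k) k + X - h (RtoC r))
      + - (csum (fun k => b k * RtoC r ^ k) k - h (RtoC r)))%C by ring end.
  eapply Rle_trans; [apply Cmod_triangle|]; rewrite Cmod_opp; lra. }
assert (B : exists K, forall k, (k <= N)%nat -> Cmod (b k) * r ^ k <= K).
{ clear -Hr; induction N as [|N [K HK]].
  - exists (Cmod (b 0%nat) * r ^ 0); intros k Hk; replace k with 0%nat by lia; lra.
  - exists (Rmax K (Cmod (b (S N)) * r ^ S N)); intros k Hk.
    destruct (Nat.eq_dec k (S N)) as [->|]; [apply Rmax_r|].
    eapply Rle_trans; [apply HK; lia|apply Rmax_l]. }
destruct B as [K HK]; exists (Rmax K 2); intros k.
destruct (Nat.le_gt_cases k N) as [L|L].
- eapply Rle_trans; [now apply HK|apply Rmax_l].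
- eapply Rle_trans; [now apply T|apply Rmax_r].
Qed.

Lemma ex_series_half K : is_series (fun k => K * (/ 2) ^ k) (K * 2).
Proof.
assert (H := is_series_geom (/ 2)).
rewrite Rabs_pos_eq in H by lra.
replace (K * 2) with (scal K (/ (1 - / 2))).
- apply (is_series_scal_l K (fun k => (/ 2) ^ k)); apply H; lra.
- unfold scal; simpl; unfold mult; simpl; field.
Qed.

(** The terms are bounded at radius [2r], which leaves a geometric factor
    [2^-k] at radius [r]. *)
Lemma entire_abs b h r :
  entire_series b h -> 0 <= r -> ex_series (fun k => Cmod (b k) * r ^ k).
Proof.
intros H Hr.
destruct (entire_coef_bounded b h (2 * r) H) as [K HK]; [lra|].
apply (ex_series_le (V := R_CompleteNormedModule) _ (fun k => K * (/ 2) ^ k)).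
- intros k; unfold norm; simpl; unfold abs; simpl.
  rewrite Rabs_pos_eq.
  + specialize (HK k); rewrite Rpow_mult_distr in HK.
    assert (P : 0 < 2 ^ k) by (apply pow_lt; lra).
    rewrite pow_inv; apply (Rmult_le_reg_r (2 ^ k)); [exact P|].
    rewrite (Rmult_assoc K), Rinv_l by lra; lra.
  + apply Rmult_le_pos; [apply Cmod_ge_0|now apply pow_le].
- exists (K * 2); apply ex_series_half.
Qed.

(** The converse of [entire_coef_bounded], by the same comparison with a
    geometric series. *)
Lemma series_of_bounded (b : nat -> C) :
  (forall r, 0 < r -> exists K, forall k, Cmod (b k) * r ^ k <= K) ->
  exists h, entire_series b h.
Proof.
intros H.
assert (E : forall z, exists l, is_series (K := C_AbsRing) (V := C_NormedModule)
    (fun k => b k * z ^ k)%C l).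
{ intros z; pose proof (Cmod_ge_0 z) as Hz.
  destruct (H (2 * (Cmod z + 1))) as [K HK]; [lra|].
  apply (ex_series_le (V := C_CompleteNormedModule) _ (fun k => K * (/ 2) ^ k)).
  - intros k; change (Cmod (b k * z ^ k) <= K * (/ 2) ^ k).
    rewrite Cmod_mult, Cmod_pow.
    specialize (HK k); rewrite Rpow_mult_distr in HK.
    assert (P : 0 < 2 ^ k) by (apply pow_lt; lra).
    rewrite pow_inv; apply (Rmult_le_reg_r (2 ^ k)); [exact P|].
    rewrite (Rmult_assoc K), Rinv_l by lra.
    assert (Q : Cmod z ^ k <= (Cmod z + 1) ^ k) by (apply pow_incr; lra).
    assert (Cmod (b k) * Cmod z ^ k <= Cmod (b k) * (Cmod z + 1) ^ k)
      by (apply Rmult_le_compat_l; [apply Cmod_ge_0|exact Q]).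
    assert (Cmod (b k) * Cmod z ^ k * 2 ^ k <= Cmod (b k) * (Cmod z + 1) ^ k * 2 ^ k)
      by (apply Rmult_le_compat_r; lra).
    lra.
  - exists (K * 2); apply ex_series_half. }
destruct (functional_choice _ E) as [h Hh].
exists h; now apply entire_series_iff.
Qed.

Lemma Cseries_unique (u : nat -> C) (l l' : C) :
  is_series (K := C_AbsRing) (V := C_NormedModule) u l ->
  is_series (K := C_AbsRing) (V := C_NormedModule) u l' -> l = l'.
Proof.
intros H H'.
exact (filterlim_locally_unique (V := C_NormedModule) (F := eventually) _ _ _ H H').
Qed.

(** The bound [k r^(k-1)] for the Lipschitz constant of a power is replaced by
    the weaker [(2r)^k], which keeps the form of the majorants used for entire
    series. *)
Lemma Cpow_diff_le (z w : C) r k :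
  1 <= r -> Cmod z <= r -> Cmod w <= r ->
  Cmod (z ^ k - w ^ k) <= (2 * r) ^ k * Cmod (z - w).
Proof.
intros Hr Hz Hw; induction k as [|k IH].
- simpl; replace (1 - 1)%C with (RtoC 0) by ring.
  rewrite Cmod_0, Rmult_1_l; apply Cmod_ge_0.
- rewrite !Cpow_S.
  replace (z * z ^ k - w * w ^ k)%C with (z * (z ^ k - w ^ k) + (z - w) * w ^ k)%C by ring.
  eapply Rle_trans; [apply Cmod_triangle|].
  rewrite !Cmod_mult, Cmod_pow.
  assert (P : Cmod w ^ k <= r * (2 * r) ^ k).
  { apply Rle_trans with (1 * (2 * r) ^ k).
    - rewrite Rmult_1_l; apply pow_incr; split; [apply Cmod_ge_0|lra].
    - apply Rmult_le_compat_r; [apply pow_le; lra|exact Hr]. }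
  pose proof (Cmod_ge_0 (z - w)); pose proof (Cmod_ge_0 z).
  pose proof (Cmod_ge_0 (z ^ k - w ^ k)).
  assert (Cmod z * Cmod (z ^ k - w ^ k) <= r * ((2 * r) ^ k * Cmod (z - w)))
    by (apply Rmult_le_compat; assumption).
  assert (Cmod (z - w) * Cmod w ^ k <= Cmod (z - w) * (r * (2 * r) ^ k))
    by (apply Rmult_le_compat_l; assumption).
  simpl; lra.
Qed.

Lemma entire_lipschitz b h r :
  entire_series b h -> 1 <= r ->
  exists L, forall z w, Cmod z <= r -> Cmod w <= r ->
    Cmod (h z - h w) <= L * Cmod (z - w).
Proof.
intros H Hr.
destruct (entire_abs b h (2 * r) H) as [S HS]; [lra|].
exists S; intros z w Hz Hw.
rewrite entire_series_iff in H.
assert (D := is_series_minus _ _ _ _ (H z) (H w)).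
rewrite Rmult_comm.
eapply (Cseries_norm_le _ _ _ _ D (is_series_scal_l (Cmod (z - w)) _ _ HS)).
intros k.
change (Cmod (b k * z ^ k - b k * w ^ k) <= Cmod (z - w) * (Cmod (b k) * (2 * r) ^ k)).
replace (b k * z ^ k - b k * w ^ k)%C with (b k * (z ^ k - w ^ k))%C by ring.
rewrite Cmod_mult.
assert (P := Cpow_diff_le z w r k Hr Hz Hw).
assert (Q := Rmult_le_compat_l _ _ _ (Cmod_ge_0 (b k)) P); lra.
Qed.

Definition Ccontinuous (h : C -> C) : Prop :=
  forall z eps, 0 < eps ->
    exists d, 0 < d /\ forall w, Cmod (w - z) < d -> Cmod (h w - h z) < eps.

Lemma entire_continuous b h : entire_series b h -> Ccontinuous h.
Proof.
intros H z eps He; pose proof (Cmod_ge_0 z) as Hz.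
destruct (entire_lipschitz b h (Cmod z + 1) H) as [L HL]; [lra|].
assert (P : 0 < Rabs L + 1) by (pose proof (Rabs_pos L); lra).
exists (Rmin 1 (eps / (Rabs L + 1))); split.
{ apply Rmin_pos; [lra|now apply Rdiv_lt_0_compat]. }
intros w Hw.
assert (W1 := Rlt_le_trans _ _ _ Hw (Rmin_l _ _)).
assert (W2 := Rlt_le_trans _ _ _ Hw (Rmin_r _ _)).
assert (T := Cmod_triangle (w - z) z).
replace (w - z + z)%C with w in T by ring.
eapply Rle_lt_trans; [apply HL; lra|].
apply Rle_lt_trans with ((Rabs L + 1) * Cmod (w - z)).
{ apply Rmult_le_compat_r; [apply Cmod_ge_0|pose proof (Rle_abs L); lra]. }
apply Rmult_lt_reg_r with (/ (Rabs L + 1)); [now apply Rinv_0_lt_compat|].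
replace ((Rabs L + 1) * Cmod (w - z) * / (Rabs L + 1)) with (Cmod (w - z)) by (field; lra).
exact W2.
Qed.

(** Comparing coefficients in [h w = (w - zeta) g w] forces the coefficients
    of [g] to be minus the partial sums of [h zeta] divided by powers of
    [zeta].  Because [h zeta = 0] these partial sums are also remainders of
    the series, and therefore small enough for [g] to converge everywhere. *)
Lemma entire_divide_root b h (zeta : C) :
  entire_series b h -> zeta <> RtoC 0 -> h zeta = RtoC 0 ->
  exists d g, entire_series d g /\ forall w, h w = ((w - zeta) * g w)%C.
Proof.
intros H Hz H0.
pose proof (proj1 (Cmod_gt_0 zeta) Hz) as Pz.
set (d := fun k => (- psum b zeta k / zeta ^ S k)%C).
assert (Pk : forall k, (zeta ^ k <> 0)%C) by (intros k; now apply Cpow_nz).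
assert (B : exists g, entire_series d g).
{ apply series_of_bounded; intros r Hr.
  (* At a radius beyond [|zeta|] the remainder gains the factor [(|zeta| /
     rho)^(k+1)]. *)
  set (rho := Rmax r (Cmod zeta)).
  assert (R1 : r <= rho) by apply Rmax_l.
  assert (R2 : Cmod zeta <= rho) by apply Rmax_r.
  destruct (entire_abs b h rho H) as [S HS]; [lra|].
  exists (S / rho); intros k.
  assert (E : Cmod (psum b zeta k) <= (Cmod zeta / rho) ^ (k + 1) * S).
  { rewrite entire_series_iff in H.
    assert (T := Cseries_tail_le _ (fun j => (Cmod zeta / rho) ^ (k + 1) * (Cmod (b j) * rho ^ j))
      _ _ k (H zeta) (is_series_scal_l ((Cmod zeta / rho) ^ (k + 1)) _ _ HS)).
    rewrite H0, rsum_scal in T; unfold psum.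
    replace (csum (fun k => b k * zeta ^ k)%C k) with
      (- (0 - csum (fun k => b k * zeta ^ k)%C k))%C by ring.
    rewrite Cmod_opp.
    assert (Q : 0 <= (Cmod zeta / rho) ^ (k + 1)).
    { apply pow_le; apply Rmult_le_pos; [lra|apply Rlt_le, Rinv_0_lt_compat; lra]. }
    assert (0 <= rsum (fun j => Cmod (b j) * rho ^ j) k).
    { apply Rle_trans with (rsum (fun _ => 0) k); [rewrite rsum_const; lra|].
      apply rsum_le; intros; apply Rmult_le_pos; [apply Cmod_ge_0|apply pow_le; lra]. }
    assert (Q2 := Rmult_le_pos _ _ Q H1).
    eapply Rle_trans; [apply T|].
    - intros j Hj; rewrite Cmod_mult, Cmod_pow.
      replace j with ((k + 1) + (j - (k + 1)))%nat by lia.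
      rewrite (pow_add (Cmod zeta) (k + 1)), (pow_add rho (k + 1)).
      unfold Rdiv; rewrite Rpow_mult_distr, pow_inv.
      assert (0 < rho ^ (k + 1)) by (apply pow_lt; lra).
      replace (Cmod zeta ^ (k + 1) * / rho ^ (k + 1) *
        (Cmod (b (k + 1 + (j - (k + 1)))%nat) * (rho ^ (k + 1) * rho ^ (j - (k + 1)))))
      with (Cmod (b (k + 1 + (j - (k + 1)))%nat) * (Cmod zeta ^ (k + 1) * rho ^ (j - (k + 1))))
      by (field; lra).
      apply Rmult_le_compat_l; [apply Cmod_ge_0|].
      apply Rmult_le_compat_l; [apply pow_le; lra|].
      apply pow_incr; lra.
    - change (scal ((Cmod zeta / rho) ^ (k + 1)) S) with ((Cmod zeta / rho) ^ (k + 1) * S); lra. }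
  unfold d; rewrite Cmod_div by apply Pk; rewrite Cmod_opp, Cmod_pow.
  replace (k + 1)%nat with (Datatypes.S k) in E by lia.
  unfold Rdiv in E; rewrite Rpow_mult_distr, pow_inv in E.
  assert (0 < Cmod zeta ^ Datatypes.S k) by now apply pow_lt.
  assert (0 < rho ^ Datatypes.S k) by (apply pow_lt; lra).
  assert (0 < rho ^ k) by (apply pow_lt; lra).
  assert (F : Cmod (psum b zeta k) / Cmod zeta ^ Datatypes.S k <= S / rho ^ Datatypes.S k).
  { apply Rmult_le_reg_r with (Cmod zeta ^ Datatypes.S k); [assumption|].
    replace (Cmod (psum b zeta k) / Cmod zeta ^ Datatypes.S k * Cmod zeta ^ Datatypes.S k)
      with (Cmod (psum b zeta k)) by (field; lra).
    lra. }
  assert (G : 0 <= S).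
  { assert (0 <= Cmod (psum b zeta k) / Cmod zeta ^ Datatypes.S k)
      by (apply Rmult_le_pos; [apply Cmod_ge_0|apply Rlt_le, Rinv_0_lt_compat; assumption]).
    apply Rmult_le_reg_r with (/ rho ^ Datatypes.S k); [now apply Rinv_0_lt_compat|].
    unfold Rdiv in *; lra. }
  apply Rle_trans with (S / rho ^ Datatypes.S k * rho ^ k).
  { apply Rmult_le_compat; [| |exact F|apply pow_incr; lra].
    - apply Rmult_le_pos; [apply Cmod_ge_0|apply Rlt_le, Rinv_0_lt_compat; assumption].
    - apply pow_le; lra. }
  simpl; right; field; split; lra. }
destruct B as [g Hg]; exists d, g; split; [exact Hg|]; intros w.
rewrite entire_series_iff in H, Hg.
assert (D0 : b 0%nat = (- zeta * d 0%nat)%C).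
{ unfold d, psum; rewrite csum_0; simpl; field; exact Hz. }
assert (DS : forall k, b (S k) = (d k - zeta * d (S k))%C).
{ intros k; unfold d, psum; rewrite csum_S.
  rewrite !Cpow_S; field; split; [apply Pk|exact Hz]. }
apply (Cseries_unique _ _ _ (H w)).
(* The product of [w] with the series of [g], shifted to start at index 1. *)
pose (a := fun k => match k with O => RtoC 0 | S k => (w * (d k * w ^ k))%C end).
assert (Sa : is_series (K := C_AbsRing) (V := C_NormedModule) a (w * g w)%C).
{ apply is_series_decr_1.
  match goal with |- is_series _ ?l =>
    replace l with (scal (K := C_AbsRing) (V := C_NormedModule) w (g w)) end.
  - apply (is_series_scal_l w _ _ (Hg w)).
  - change ((w * g w)%C = (w * g w + - 0)%C); ring. }
assert (Sm := is_series_minus _ _ _ _ Sa (is_series_scal_l zeta _ _ (Hg w))).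
match type of Sm with is_series _ ?l =>
  replace ((w - zeta) * g w)%C with l end.
2:{ change ((w * g w + - (zeta * g w))%C = ((w - zeta) * g w)%C); ring. }
eapply is_series_ext; [|exact Sm].
intros [|k].
- change ((0 + - (zeta * (d 0%nat * w ^ 0)))%C = (b 0%nat * w ^ 0)%C).
  rewrite D0; ring.
- change ((w * (d k * w ^ k) + - (zeta * (d (S k) * w ^ S k)))%C = (b (S k) * w ^ S k)%C).
  rewrite DS, Cpow_S; ring.
Qed.

(** * Coefficient estimates by averaging over roots of unity *)

Definition cis (t : R) : C := (cos t, sin t).

Lemma cis_0 : cis 0 = RtoC 1.
Proof. unfold cis; rewrite cos_0, sin_0; reflexivity. Qed.

Lemma cis_plus s t : cis (s + t) = (cis s * cis t)%C.
Proof. unfold cis, Cmult; simpl; rewrite cos_plus, sin_plus; f_equal; ring. Qed.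

Lemma Cconj_cis t : Cconj (cis t) = cis (- t).
Proof. unfold cis, Cconj; simpl; rewrite cos_neg, sin_neg; reflexivity. Qed.

Lemma cis_pow t n : (cis t ^ n)%C = cis (INR n * t).
Proof.
induction n as [|n IH].
- simpl; rewrite Rmult_0_l, cis_0; reflexivity.
- rewrite Cpow_S, IH, <- cis_plus, S_INR; f_equal; ring.
Qed.

Lemma Cmod_cis t : Cmod (cis t) = 1.
Proof.
unfold Cmod, cis; simpl.
replace (cos t * (cos t * 1) + sin t * (sin t * 1)) with (Rsqr (sin t) + Rsqr (cos t))
  by (unfold Rsqr; ring).
rewrite sin2_cos2; apply sqrt_1.
Qed.

Lemma cis_2PI n : cis (2 * PI * INR n) = RtoC 1.
Proof.
replace (2 * PI * INR n) with (INR n * (2 * PI)) by ring.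
rewrite <- cis_pow.
unfold cis; rewrite cos_2PI, sin_2PI; apply (Cpow_1_l n).
Qed.

Lemma cis_neq_1 t : - PI < t < PI -> t <> 0 -> cis (2 * t) <> RtoC 1.
Proof.
intros Ht H0 E.
assert (Hc : cos (2 * t) = 1) by exact (f_equal fst E).
rewrite cos_2a_sin in Hc.
assert (Hs : sin t = 0) by nra.
destruct (Rtotal_order t 0) as [H|[H|H]]; [|lra|].
- assert (0 < sin (- t)) by (apply sin_gt_0; lra); rewrite sin_neg in *; lra.
- assert (0 < sin t) by (apply sin_gt_0; lra); lra.
Qed.

Lemma geometric_csum x n : ((x - 1) * csum (fun i => x ^ i) n)%C = (x ^ S n - 1)%C.
Proof.
induction n as [|n IH]; [rewrite csum_0; simpl; ring|].
rewrite csum_S, Cmult_plus_distr_l, IH, !Cpow_S; ring.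
Qed.

Definition root_of_unity (N i : nat) : C := cis (2 * PI * INR i / INR (S N)).

(** The summands are the powers of a single root of unity different from 1, so
    the geometric sum vanishes. *)
Lemma csum_root_of_unity_orthogonal N p k :
  (p <= N)%nat -> (k <= N)%nat -> p <> k ->
  csum (fun i => root_of_unity N i ^ p * Cconj (root_of_unity N i) ^ k)%C N = RtoC 0.
Proof.
intros Hp Hk Hpk.
pose proof (lt_0_INR (S N) ltac:(lia)) as HM.
set (t := PI * (INR p - INR k) / INR (S N)).
rewrite (csum_ext _ (fun i => cis (2 * t) ^ i)%C).
2:{ intros i _; unfold root_of_unity.
    rewrite Cconj_cis, !cis_pow, <- cis_plus; f_equal; unfold t; field; lra. }
assert (Hx : (cis (2 * t) - 1)%C <> RtoC 0).
{ intros E; assert (E' : cis (2 * t) = RtoC 1).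
  { replace (cis (2 * t)) with ((cis (2 * t) - 1) + 1)%C by ring; rewrite E; ring. }
  revert E'; apply cis_neq_1.
  - pose proof PI_RGT_0.
    assert (INR p < INR (S N)) by (apply lt_INR; lia).
    assert (INR k < INR (S N)) by (apply lt_INR; lia).
    pose proof (pos_INR p); pose proof (pos_INR k).
    unfold t; split; apply Rmult_lt_reg_r with (INR (S N)); try assumption;
      unfold Rdiv; rewrite Rmult_assoc, Rinv_l by lra; nra.
  - assert (INR p - INR k <> 0) by (apply Rminus_eq_contra, not_INR; exact Hpk).
    unfold t; apply Rmult_integral_contrapositive_currified;
    [apply Rmult_integral_contrapositive_currified; [apply PI_neq0|assumption]|].
    apply Rinv_neq_0_compat; lra. }
assert (G := geometric_csum (cis (2 * t)) N).
assert (E1 : (cis (2 * t) ^ S N)%C = RtoC 1).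
{ rewrite cis_pow.
  replace (INR (S N) * (2 * t)) with (2 * PI * INR p + - (2 * PI * INR k))
    by (unfold t; field; lra).
  rewrite cis_plus, <- Cconj_cis, !cis_2PI.
  unfold Cconj, Cmult; simpl; unfold RtoC; f_equal; ring. }
rewrite E1 in G; unfold Cminus in G at 2; rewrite Cplus_opp_r in G.
destruct (Ceq_dec (csum (fun i => cis (2 * t) ^ i)%C N) 0) as [E|E]; [exact E|].
exfalso; exact (Cmult_neq_0 _ _ Hx E G).
Qed.

Lemma Cconj_csum u n : Cconj (csum u n) = csum (fun k => Cconj (u k)) n.
Proof.
induction n as [|n IH]; [now rewrite !csum_0|].
now rewrite !csum_S, Cplus_conj, IH.
Qed.

Lemma csum_const c n : csum (fun _ => c) n = (RtoC (INR (S n)) * c)%C.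
Proof.
induction n as [|n IH].
- rewrite csum_0; simpl; ring.
- rewrite csum_S, IH, (S_INR (S n)), RtoC_plus; ring.
Qed.

Lemma csum_single (u : nat -> C) n k :
  (k <= n)%nat -> (forall p, (p <= n)%nat -> p <> k -> u p = RtoC 0) ->
  csum u n = u k.
Proof.
assert (Z : forall m, (forall p, (p <= m)%nat -> u p = RtoC 0) -> csum u m = RtoC 0).
{ intros m H; rewrite (csum_ext _ (fun _ => RtoC 0) _ H), csum_const; ring. }
induction n as [|n IH]; intros Hk H.
- replace k with 0%nat by lia; apply csum_0.
- rewrite csum_S; destruct (Nat.eq_dec k (S n)) as [->|Hne].
  + rewrite Z; [ring|]; intros p Hp; apply H; lia.
  + rewrite IH, (H (S n)); [ring|lia|lia|lia|]; intros p Hp; apply H; lia.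
Qed.

Lemma Cmod_root N i : Cmod (root_of_unity N i) = 1.
Proof. apply Cmod_cis. Qed.

Lemma root_mult_conj N i :
  (root_of_unity N i * Cconj (root_of_unity N i))%C = RtoC 1.
Proof. rewrite <- Cmod2_conj, Cmod_root; unfold RtoC; simpl; f_equal; ring. Qed.

(** The discrete form of Cauchy's formula for the coefficients: it is exact as
    soon as the number of nodes exceeds the degree. *)
Lemma circle_sum_coef b n k N :
  (k <= n)%nat -> (n <= N)%nat ->
  csum (fun i => psum b (root_of_unity N i) n * Cconj (root_of_unity N i) ^ k)%C N
  = (RtoC (INR (S N)) * b k)%C.
Proof.
intros Hk Hn.
transitivity (csum (fun p => csum (fun i =>
  b p * (root_of_unity N i ^ p * Cconj (root_of_unity N i) ^ k))%C N) n).
{ rewrite <- csum_switch; apply csum_ext; intros i _.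
  unfold psum; rewrite Cmult_comm, <- csum_scal; apply csum_ext; intros; ring. }
rewrite (csum_single _ n k Hk).
- rewrite (csum_ext _ (fun _ => b k)), csum_const; [reflexivity|].
  intros i _; rewrite <- Cpow_mult_l, root_mult_conj, Cpow_1_l; ring.
- intros p Hp Hne; rewrite csum_scal.
  rewrite csum_root_of_unity_orthogonal by lia; ring.
Qed.

(** Conjugating a polynomial reverses its frequencies, so the conjugate has no
    component of positive frequency. *)
Lemma circle_sum_conj b n k N :
  (1 <= k)%nat -> (n + k <= N)%nat ->
  csum (fun i => Cconj (psum b (root_of_unity N i) n) * Cconj (root_of_unity N i) ^ k)%C N
  = RtoC 0.
Proof.
intros Hk Hn.
transitivity (csum (fun p => csum (fun i =>
  Cconj (b p) * Cconj (root_of_unity N i ^ (p + k) * Cconj (root_of_unity N i) ^ 0))%C N) n).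
{ rewrite <- csum_switch; apply csum_ext; intros i _.
  unfold psum; rewrite Cconj_csum, Cmult_comm, <- csum_scal; apply csum_ext; intros p _.
  rewrite !Cmult_conj, !Cpow_conj, Cpow_add_r; simpl.
  replace (Cconj (RtoC 1)) with (RtoC 1) by (unfold Cconj, RtoC; simpl; f_equal; ring).
  ring. }
rewrite (csum_ext _ (fun _ => RtoC 0)), csum_const; [ring|].
intros p Hp; rewrite csum_scal, <- Cconj_csum, csum_root_of_unity_orthogonal by lia.
unfold Cconj, RtoC; simpl; rewrite Ropp_0; apply Cmult_0_r.
Qed.

Lemma polynomial_cauchy_estimate b n k B :
  (forall z, Cmod z = 1 -> Cmod (psum b z n) <= B) -> (k <= n)%nat ->
  Cmod (b k) <= B.
Proof.
intros H Hk.
assert (E := f_equal Cmod (circle_sum_coef b n k n Hk (le_n n))).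
pose proof (lt_0_INR (S n) ltac:(lia)) as HM.
rewrite Cmod_mult, Cmod_R, (Rabs_pos_eq (INR (S n))) in E by lra.
apply Rmult_le_reg_l with (INR (S n)); [exact HM|].
rewrite <- E, <- rsum_const; apply Cmod_csum_le; intros i _.
rewrite Cmod_mult, Cmod_pow, Cmod_conj, Cmod_root, pow1, Rmult_1_r.
apply H, Cmod_root.
Qed.

(** By [circle_sum_coef] and [circle_sum_conj], [b k] is the average of [2 Re
    P - 2 A] against a unimodular factor, where the constant [2 A] averages to
    zero.  The integrand has constant sign, so the absolute value of the
    average is at most the average of [2 A - 2 Re P], which is [2 A] because
    [P] vanishes at 0. *)
Lemma polynomial_borel_caratheodory b n k A :
  b 0%nat = RtoC 0 -> (forall z, Cmod z = 1 -> Re (psum b z n) <= A) ->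
  (1 <= k <= n)%nat -> Cmod (b k) <= 2 * A.
Proof.
intros H0 H [Hk Hkn].
(* Enough nodes for the products of the conjugate with the frequency [k] as
   well. *)
set (N := (n + k)%nat).
pose proof (lt_0_INR (S N) ltac:(lia)) as HM.
set (w := root_of_unity N).
assert (E : (RtoC (INR (S N)) * b k)%C = csum (fun i =>
   (RtoC (2 * Re (psum b (w i) n) - 2 * A) * Cconj (w i) ^ k))%C N).
{ rewrite <- (circle_sum_coef b n k N) by lia.
  rewrite (csum_ext (fun i => (RtoC (2 * Re (psum b (w i) n) - 2 * A) * Cconj (w i) ^ k))%C
    (fun i => (psum b (w i) n * Cconj (w i) ^ k)
      + (Cconj (psum b (w i) n) * Cconj (w i) ^ k
         + (- RtoC (2 * A)) * (w i ^ 0 * Cconj (w i) ^ k)))%C).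
  - unfold w; rewrite !csum_plus, csum_scal.
    rewrite circle_sum_conj, csum_root_of_unity_orthogonal by lia; ring.
  - intros i _.
    replace (RtoC (2 * Re (psum b (w i) n) - 2 * A)) with
      (psum b (w i) n + Cconj (psum b (w i) n) - RtoC (2 * A))%C.
    + simpl; ring.
    + destruct (psum b (w i) n) as [x y]; unfold RtoC, Cminus, Cplus, Cconj, Copp, Re; simpl;
      f_equal; ring. }
apply (f_equal Cmod) in E.
rewrite Cmod_mult, Cmod_R, (Rabs_pos_eq (INR (S N))) in E by lra.
apply Rmult_le_reg_l with (INR (S N)); [exact HM|].
rewrite E.
apply Rle_trans with (rsum (fun i => 2 * A + (-2) * Re (psum b (w i) n)) N).
- apply Cmod_csum_le; intros i _.
  rewrite Cmod_mult, Cmod_pow, Cmod_conj, Cmod_R; unfold w; rewrite Cmod_root, pow1, Rmult_1_r.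
  specialize (H _ (Cmod_root N i)); rewrite Rabs_left1; lra.
- right.
  assert (Z := circle_sum_coef b n 0 N ltac:(lia) ltac:(lia)).
  apply (f_equal Re) in Z; rewrite H0, Cmult_0_r, Re_csum in Z; change (Re (RtoC 0)) with 0 in Z.
  assert (P : rsum (fun i => 2 * A + -2 * Re (psum b (w i) n)) N
    = rsum (fun _ => 2 * A) N + rsum (fun i => -2 * Re (psum b (w i) n)) N)
    by apply (sum_n_plus (G := R_AbelianGroup)).
  rewrite P, rsum_const, rsum_scal.
  assert (Q : rsum (fun i => Re (psum b (w i) n)) N = 0).
  { etransitivity; [|exact Z]; apply sum_n_ext; intros i.
    unfold w; change (Cconj (root_of_unity N i) ^ 0)%C with (RtoC 1); now rewrite Cmult_1_r. }
  rewrite Q; ring.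
Qed.

Lemma entire_uniform b h r eps :
  entire_series b h -> 0 <= r -> 0 < eps ->
  exists N, forall n, (N <= n)%nat -> forall z, Cmod z <= r ->
    Cmod (h z - psum b z n) <= eps.
Proof.
intros H Hr He.
destruct (entire_abs b h r H Hr) as [s Hs].
rewrite entire_series_iff in H.
destruct (proj1 (Rseries_iff _ _) Hs eps He) as [N HN].
exists N; intros n Hn z Hz.
specialize (HN n Hn); apply Rabs_def2 in HN.
apply Rle_trans with (s - rsum (fun k => Cmod (b k) * r ^ k) n); [|lra].
apply (Cseries_tail_le _ _ _ _ n (H z) Hs).
intros k _; rewrite Cmod_mult, Cmod_pow.
apply Rmult_le_compat_l; [apply Cmod_ge_0|].
apply pow_incr; split; [apply Cmod_ge_0|exact Hz].
Qed.

Lemma psum_dilate b (r : R) z n :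
  psum (fun k => b k * RtoC r ^ k)%C z n = psum b (RtoC r * z) n.
Proof. apply csum_ext; intros k _; rewrite Cpow_mult_l; ring. Qed.

(** The estimate for polynomials applied to Taylor polynomials, which
    approximate [h] uniformly on the circle. *)
Lemma entire_cauchy_estimate b h rho B k :
  entire_series b h -> 0 < rho ->
  (forall z, Cmod z = rho -> Cmod (h z) <= B) -> Cmod (b k) * rho ^ k <= B.
Proof.
intros H Hr HB.
apply le_epsilon; intros eps He.
destruct (entire_uniform b h rho eps H ltac:(lra) He) as [N HN].
assert (P := polynomial_cauchy_estimate (fun k => b k * RtoC rho ^ k)%C (N + k) k (B + eps)).
simpl in P; rewrite Cmod_mult, Cmod_pow, Cmod_R, Rabs_pos_eq in P by lra.
apply P; [|lia].
intros z Hz; rewrite psum_dilate.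
assert (Q : Cmod (RtoC rho * z) = rho) by (rewrite Cmod_mult, Cmod_R, Hz, Rabs_pos_eq; lra).
specialize (HN (N + k)%nat ltac:(lia) (RtoC rho * z)%C ltac:(lra)).
specialize (HB _ Q).
replace (psum b (RtoC rho * z) (N + k)) with
 (h (RtoC rho * z)%C + - (h (RtoC rho * z)%C - psum b (RtoC rho * z) (N + k)))%C by ring.
eapply Rle_trans; [apply Cmod_triangle|]; rewrite Cmod_opp; lra.
Qed.

(** * The logarithm of a product of linear factors *)

(** A polynomial with constant term 1 is described by the reciprocals of its
    roots, which leaves no leading coefficient to keep track of. *)
Definition linprod (u : list C) (z : C) : C :=
  fold_right (fun v p => ((1 - v * z) * p)%C) (RtoC 1) u.

(** The Taylor coefficients of [log (1 - v z)]. *)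
Definition log_coef (v : C) (k : nat) : C :=
  match k with O => RtoC 0 | S _ => (- v ^ k / RtoC (INR k))%C end.

(** The error of the Taylor polynomial of degree [P] of [ln |1 - t v|], as a
    function of the position [t] on the ray through [v].  Defined by recursion
    on [P] so that its derivative can be computed one term at a time. *)
Fixpoint ray_error (v : C) (P : nat) (t : R) : R :=
  match P with
  | O => ln ((1 - t * Re v) ^ 2 + (t * Im v) ^ 2) / 2
  | S Q => ray_error v Q t + t ^ P * Re (v ^ P)%C / INR P
  end.

Lemma ln_Cmod z : z <> RtoC 0 -> ln (Cmod z) = ln (Re z ^ 2 + Im z ^ 2) / 2.
Proof.
intros Hz; rewrite <- Cmod2_alt, ln_pow by now apply Cmod_gt_0.
simpl; field.
Qed.

Lemma one_minus_neq_0 v : Cmod v < 1 -> (1 - v)%C <> RtoC 0.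
Proof.
intros Hv E; replace v with (RtoC 1) in Hv; [rewrite Cmod_1 in Hv; lra|].
replace v with (1 - (1 - v))%C by ring; rewrite E; ring.
Qed.

Lemma ray_error_at_0 v P : ray_error v P 0 = 0.
Proof.
induction P as [|P IH].
- simpl; replace ((1 - 0 * Re v) * ((1 - 0 * Re v) * 1) + 0 * Im v * (0 * Im v * 1)) with 1 by ring.
  rewrite ln_1; field.
- change (ray_error v P 0 + 0 ^ S P * Re (v ^ S P)%C / INR (S P) = 0).
  rewrite IH, pow_i by lia; unfold Rdiv; ring.
Qed.

Lemma ray_error_at_1 v P :
  Cmod v < 1 -> ray_error v P 1 = ln (Cmod (1 - v)) - Re (csum (log_coef v) P).
Proof.
intros Hv; induction P as [|P IH].
- rewrite csum_0, ln_Cmod by now apply one_minus_neq_0.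
  destruct v as [x y]; simpl.
  match goal with |- ln ?a / 2 = ln ?b / 2 - 0 => replace b with a by ring end; ring.
- change (ray_error v P 1 + 1 ^ S P * Re (v ^ S P)%C / INR (S P)
    = ln (Cmod (1 - v)) - Re (csum (log_coef v) (S P))).
  rewrite csum_S, IH, pow1.
  pose proof (lt_0_INR (S P) ltac:(lia)).
  assert (E : Re (log_coef v (S P)) = - (Re (v ^ S P)%C / INR (S P))).
  { unfold log_coef; destruct (v ^ S P)%C as [x y].
    unfold Cdiv; rewrite <- RtoC_inv by lra; simpl; field.
    change (INR (S P) <> 0); lra. }
  change (Re (csum (log_coef v) P + log_coef v (S P))%C)
    with (Re (csum (log_coef v) P) + Re (log_coef v (S P))).
  rewrite E; unfold Rdiv; ring.
Qed.

Lemma Cmod_scaled_lt_1 v t : Cmod v < 1 -> 0 <= t <= 1 -> Cmod (RtoC t * v) < 1.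
Proof.
intros Hv Ht; rewrite Cmod_mult, Cmod_R, Rabs_pos_eq by lra.
pose proof (Cmod_ge_0 v); nra.
Qed.

(** Only the remainder of a geometric series is left in the derivative, since
    the terms of lower degree cancel. *)
Lemma is_derive_ray_error v P t :
  Cmod v < 1 -> 0 <= t <= 1 ->
  is_derive (ray_error v P) t
    (Re (- v * (RtoC t * v) ^ P / (1 - RtoC t * v))%C).
Proof.
intros Hv Ht.
assert (H1 := one_minus_neq_0 _ (Cmod_scaled_lt_1 v t Hv Ht)).
assert (D : 0 < (1 - t * Re v) ^ 2 + (t * Im v) ^ 2).
{ apply Cmod_gt_0 in H1; apply (pow_lt _ 2) in H1; rewrite Cmod2_alt in H1.
  destruct v as [x y]; simpl in H1 |- *.
  match goal with |- 0 < ?a => match type of H1 with 0 < ?b =>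
    replace a with b by ring end end; exact H1. }
induction P as [|P IH].
- change ((RtoC t * v) ^ 0)%C with (RtoC 1); rewrite Cmult_1_r; unfold ray_error.
  auto_derive.
  + simpl in D; lra.
  + destruct v as [x y]; simpl in D |- *. field; intros E; nra.
- change (is_derive (fun t => ray_error v P t + t ^ S P * Re (v ^ S P)%C / INR (S P)) t
    (Re (- v * (RtoC t * v) ^ S P / (1 - RtoC t * v))%C)).
  replace (Re (- v * (RtoC t * v) ^ S P / (1 - RtoC t * v))%C) with
    (plus (Re (- v * (RtoC t * v) ^ P / (1 - RtoC t * v))%C) (t ^ P * Re (v ^ S P)%C)).
  + apply (is_derive_plus (ray_error v P)); [exact IH|].
    set (c := Re (v ^ S P)%C).
    assert (Hn : INR (S P) <> 0) by (apply not_0_INR; lia).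
    apply (is_derive_ext (fun t => c / INR (S P) * t ^ S P));
      [intros s; change (c / INR (S P) * s ^ S P = s ^ S P * c / INR (S P)); unfold Rdiv; ring|].
    replace (t ^ P * c) with (c / INR (S P) * (INR (S P) * 1 * t ^ P)) by (field; exact Hn).
    apply (is_derive_scal (fun t => t ^ S P)).
    apply (is_derive_pow (fun t => t) (S P)); exact (is_derive_id (K := R_AbsRing) t).
  + change (Re (- v * (RtoC t * v) ^ P / (1 - RtoC t * v))%C + t ^ P * Re (v ^ S P)%C
     = Re (- v * (RtoC t * v) ^ S P / (1 - RtoC t * v))%C).
    assert (S1 : t ^ P * Re (v ^ S P)%C = Re (RtoC t ^ P * v ^ S P)%C).
    { rewrite <- RtoC_pow; destruct (v ^ S P)%C as [x y]; simpl; ring. }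
    rewrite S1.
    change (Re (- v * (RtoC t * v) ^ P / (1 - RtoC t * v) + RtoC t ^ P * v ^ S P)%C
     = Re (- v * (RtoC t * v) ^ S P / (1 - RtoC t * v))%C).
    f_equal; rewrite !Cpow_S, Cpow_mult_l; field; exact H1.
Qed.

(** The derivative of [ray_error] along the segment from 0 to [v] is at most
    the right-hand side, so the mean value theorem applies. *)
Lemma log_series_truncation v r P :
  Cmod v <= r -> r < 1 ->
  Rabs (ln (Cmod (1 - v)) - Re (csum (log_coef v) P)) <= r ^ S P / (1 - r).
Proof.
intros Hv Hr; pose proof (Cmod_ge_0 v) as Hv0.
rewrite <- ray_error_at_1 by lra.
destruct (MVT_gen (ray_error v P) 0 1
  (fun t => Re (- v * (RtoC t * v) ^ P / (1 - RtoC t * v))%C)) as [t [Ht E]].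
- rewrite Rmin_left, Rmax_right by lra; intros t Ht; apply is_derive_ray_error; lra.
- rewrite Rmin_left, Rmax_right by lra; intros t Ht.
  apply continuity_pt_filterlim, (ex_derive_continuous (ray_error v P)).
  eexists; apply is_derive_ray_error; lra.
- rewrite Rmin_left, Rmax_right in Ht by lra.
  rewrite ray_error_at_0, !Rminus_0_r, Rmult_1_r in E; rewrite E.
  eapply Rle_trans; [apply re_le_Cmod|].
  assert (H1 := one_minus_neq_0 _ (Cmod_scaled_lt_1 v t ltac:(lra) Ht)).
  assert (Q : Cmod (RtoC t * v) <= r).
  { rewrite Cmod_mult, Cmod_R, Rabs_pos_eq by lra; nra. }
  assert (L : 1 - r <= Cmod (1 - RtoC t * v)).
  { assert (T := Cmod_triangle (1 - RtoC t * v) (RtoC t * v)).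
    replace (1 - RtoC t * v + RtoC t * v)%C with (RtoC 1) in T by ring.
    rewrite Cmod_1 in T; lra. }
  rewrite Cmod_div by exact H1; rewrite Cmod_mult, Cmod_opp, Cmod_pow.
  apply Rmult_le_compat.
  + apply Rmult_le_pos; [exact Hv0|apply pow_le, Cmod_ge_0].
  + apply Rlt_le, Rinv_0_lt_compat; lra.
  + simpl; apply Rmult_le_compat; [exact Hv0|apply pow_le, Cmod_ge_0|exact Hv|].
    apply pow_incr; split; [apply Cmod_ge_0|exact Q].
  + apply Rinv_le_contravar; lra.
Qed.

Definition linprod_log_coef (u : list C) (k : nat) : C :=
  fold_right (fun v s => (log_coef v k + s)%C) (RtoC 0) u.

Lemma linprod_neq_0 u z :
  (forall v, In v u -> Cmod (v * z) < 1) -> linprod u z <> RtoC 0.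
Proof.
induction u as [|v u IH]; intros H; simpl.
- apply C1_nz.
- apply Cmult_neq_0; [apply one_minus_neq_0, H; now left|].
  apply IH; intros x Hx; apply H; now right.
Qed.

Lemma log_coef_mult v z k : log_coef (v * z) k = (log_coef v k * z ^ k)%C.
Proof.
destruct k as [|k]; unfold log_coef; [simpl; ring|].
rewrite Cpow_mult_l; field.
intros E; apply (f_equal fst) in E; revert E; apply not_0_INR; lia.
Qed.

Lemma linprod_log_truncation u z r P :
  (forall v, In v u -> Cmod v <= r) -> r < 1 -> 0 <= r -> Cmod z <= 1 ->
  Rabs (ln (Cmod (linprod u z)) - Re (psum (linprod_log_coef u) z P))
    <= INR (length u) * (r ^ S P / (1 - r)).
Proof.
intros Hu Hr Hr0 Hz; induction u as [|v u IH].
- change (linprod nil z) with (RtoC 1); rewrite Cmod_1, ln_1.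
  unfold psum; rewrite (csum_ext _ (fun _ => RtoC 0)), csum_const by (intros; simpl; ring).
  rewrite Cmult_0_r; simpl; rewrite Rminus_0_r, Rabs_R0; lra.
- assert (Hvz : forall w, In w (v :: u) -> Cmod (w * z) <= r).
  { intros w Hw; specialize (Hu w Hw); rewrite Cmod_mult.
    pose proof (Cmod_ge_0 w); pose proof (Cmod_ge_0 z); nra. }
  specialize (IH (fun w Hw => Hu w (or_intror Hw))).
  assert (T := log_series_truncation (v * z) r P (Hvz v (or_introl eq_refl)) Hr).
  change (linprod (v :: u) z) with ((1 - v * z) * linprod u z)%C.
  rewrite Cmod_mult, ln_mult.
  2:{ apply Cmod_gt_0, one_minus_neq_0; specialize (Hvz v (or_introl eq_refl)); lra. }
  2:{ apply Cmod_gt_0, linprod_neq_0; intros w Hw; specialize (Hvz w (or_intror Hw)); lra. }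
  assert (E : psum (linprod_log_coef (v :: u)) z P
    = (csum (log_coef (v * z)) P + psum (linprod_log_coef u) z P)%C).
  { unfold psum; rewrite <- csum_plus; apply csum_ext; intros k _.
    rewrite log_coef_mult; simpl; ring. }
  rewrite E.
  change (Re (csum (log_coef (v * z)) P + psum (linprod_log_coef u) z P)%C)
   with (Re (csum (log_coef (v * z)) P) + Re (psum (linprod_log_coef u) z P)).
  change (length (v :: u)) with (S (length u)); rewrite S_INR.
  apply Rabs_le_between in T; apply Rabs_le_between in IH; apply Rabs_le_between; lra.
Qed.

(** The constant term is absent, which is why the bound vanishes with [x]. *)
Lemma rsum_geometric_half_le c x P :
  0 <= c -> 0 <= x <= / 2 ->
  rsum (fun k => match k with O => 0 | S _ => c * x ^ k end) P <= 2 * c * x.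
Proof.
intros Hc Hx.
apply Rle_trans with (2 * c * x * (1 - (/ 2) ^ P)).
- induction P as [|P IH]; [rewrite rsum_0; simpl; lra|].
  rewrite rsum_S; simpl.
  assert (x ^ P <= (/ 2) ^ P) by (apply pow_incr; lra).
  assert (c * x * x ^ P <= c * x * (/ 2) ^ P) by (apply Rmult_le_compat_l; nra).
  nra.
- assert (0 < (/ 2) ^ P) by (apply pow_lt; lra).
  assert (0 <= 2 * c * x * (/ 2) ^ P) by (apply Rmult_le_pos; nra). lra.
Qed.

(** A long enough truncation [L] of the logarithmic series satisfies [Re L <=
    A + e] on the unit circle; [polynomial_borel_caratheodory] bounds its
    coefficients by [2 (A + e)], and summing the geometric series at [z] gives
    the factor 4. *)
Lemma linprod_log_bound u r A z :
  (forall v, In v u -> Cmod v <= r) -> 0 <= r < 1 -> 0 <= A ->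
  (forall w, Cmod w = 1 -> ln (Cmod (linprod u w)) <= A) ->
  Cmod z <= / 2 -> Rabs (ln (Cmod (linprod u z))) <= 4 * A * Cmod z.
Proof.
intros Hu [Hr0 Hr] HA HB Hz; pose proof (Cmod_ge_0 z) as Hz0.
apply le_epsilon; intros eps He.
set (e := eps / 3).
assert (Hlim : is_lim_seq (fun P => INR (length u) / (1 - r) * r ^ P) (INR (length u) / (1 - r) * 0)).
{ apply (is_lim_seq_scal_l (fun P => r ^ P) _ 0), is_lim_seq_geom.
  rewrite Rabs_pos_eq; lra. }
rewrite Rmult_0_r in Hlim; apply is_lim_seq_spec in Hlim.
destruct (Hlim (mkposreal e ltac:(unfold e; lra))) as [P HP].
specialize (HP (S P) ltac:(lia)); simpl pos in HP; rewrite Rminus_0_r in HP.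
assert (Herr : INR (length u) * (r ^ S P / (1 - r)) <= e).
{ replace (INR (length u) * (r ^ S P / (1 - r))) with (INR (length u) / (1 - r) * r ^ S P)
    by (field; lra).
  eapply Rle_trans; [apply Rle_abs|lra]. }
assert (T := fun w => linprod_log_truncation u w r P Hu Hr Hr0).
assert (Hcoef : forall k, (k <= P)%nat ->
  Cmod (linprod_log_coef u k * z ^ k) <= match k with O => 0 | S _ => 2 * (A + e) * Cmod z ^ k end).
{ assert (Z : linprod_log_coef u 0%nat = RtoC 0).
  { clear; induction u as [|v u IH]; [reflexivity|].
    change (0 + linprod_log_coef u 0 = 0)%C; rewrite IH; ring. }
  intros [|k] Hk; [rewrite Z, Cmult_0_l, Cmod_0; lra|].
  rewrite Cmod_mult, Cmod_pow; apply Rmult_le_compat_r; [now apply pow_le|].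
  apply (polynomial_borel_caratheodory _ P); [exact Z| |lia].
  intros w Hw; specialize (T w ltac:(lra)); specialize (HB w Hw).
  apply Rabs_le_between in T; lra. }
specialize (T z ltac:(lra)).
assert (Hs : Cmod (psum (linprod_log_coef u) z P) <= 2 * (2 * (A + e)) * Cmod z).
{ eapply Rle_trans; [apply Cmod_csum_le, Hcoef|].
  apply (rsum_geometric_half_le (2 * (A + e)) (Cmod z)); unfold e; lra. }
assert (R := re_le_Cmod (psum (linprod_log_coef u) z P)).
apply Rabs_le_between in T.
assert (Rabs (Re (psum (linprod_log_coef u) z P)) <= 2 * (2 * (A + e)) * Cmod z) by lra.
apply Rabs_le_between in H; apply Rabs_le_between.
assert (e * Cmod z <= e * / 2) by (apply Rmult_le_compat_l; unfold e; lra).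
unfold e in *; lra.
Qed.

(** * Polynomials as products of linear factors *)

Module Import Factorisation.
Import all_boot all_algebra Rstruct complex GRing.Theory.
Local Notation Ri := (R[i]%type).
Definition toRi (z : Complex.C) : Ri := Complex z.1 z.2.
Definition ofRi (z : Ri) : C := (complex.Re z, complex.Im z).
Lemma toRiK z : ofRi (toRi z) = z. Proof. by case: z. Qed.
Lemma ofRiK z : toRi (ofRi z) = z. Proof. by case: z. Qed.
Lemma toRiD z w : toRi (Cplus z w) = (toRi z + toRi w)%R. Proof. by []. Qed.
Lemma toRiM z w : toRi (Cmult z w) = (toRi z * toRi w)%R. 
Proof. by []. Qed.
Lemma toRiN z : toRi (Copp z) = (- toRi z)%R. Proof. by []. Qed.
Lemma toRi1 : toRi (RtoC 1) = 1%R. Proof. by []. Qed.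
Lemma toRiX z n : toRi (Cpow z n) = (toRi z ^+ n)%R.
Proof. by elim: n => [|n IH] //=; rewrite exprS -IH. Qed.

(** The complex numbers, as pairs of reals, are identified with the algebraic
    closure [R[i]] of the real closed field of reals, where a polynomial
    splits as a constant times a product of [x - r]; dividing by its value 1
    at 0 leaves the factors [1 - x / r]. *)
Theorem polynomial_factorisation (q : nat -> C) (n : nat) :
  q 0%N = RtoC 1 -> 
  exists u : list C, forall z : C, 
    psum q z n = linprod u z.
Proof.
move=> q0.
pose p : {poly Ri} := (\poly_(i < n.+1) toRi (q i))%R.
have ev z : toRi (sum_n (fun k => Cmult (q k) (Cpow z k)) n) = p.[toRi z]%R.
  rewrite horner_poly; elim: n {p} => [|n IH].
    by rewrite sum_O big_ord_recl big_ord0 addr0 toRiM toRiX.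
  by rewrite sum_Sn big_ord_recr -IH -toRiX -toRiM.
have [r pE] := closed_field_poly_normal p.
have p0 : (p.[0] = 1)%R.
  by rewrite horner_coef0 coef_poly /= q0.
exists [seq ofRi (x^-1)%R | x <- r] => z.
rewrite /psum /csum -[LHS]toRiK ev -[RHS]toRiK; congr ofRi.
have evr y : (p.[y] = lead_coef p * \prod_(x <- r) (y - x))%R.
  rewrite {1}pE hornerZ horner_prod; congr (_ * _)%R.
  by apply: eq_bigr => x _; rewrite hornerXsubC.
have -> : (p.[toRi z] = p.[toRi z] / p.[0])%R by rewrite p0 divr1.
have lc : lead_coef p != 0%R.
  by apply/eqP => E; move: p0; rewrite evr E mul0r => /esym/eqP; rewrite oner_eq0.
have r0 : (0%R : Ri) \notin r.
  apply/negP => r0; move: p0; rewrite evr (big_rem _ r0) /= subr0 mul0r mulr0.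
  by move=> /esym/eqP; rewrite oner_eq0.
rewrite !evr invfM mulrACA divff // mul1r {p ev pE p0 evr lc}.
elim: r r0 => [|x r IH] /=; first by rewrite !big_nil divr1.
rewrite inE negb_or eq_sym => /andP[x0 r0]; rewrite !big_cons invfM mulrACA IH //.
rewrite toRiM; congr (_ * _)%R.
rewrite toRiD toRiN toRiM ofRiK toRi1 sub0r invrN mulrN mulrBl divff //.
by rewrite opprB mulrC.
Qed.
End Factorisation.

(** * Zero-free entire functions are close to constant *)

Lemma Cmod_le_Re_Im x y : Cmod (x, y) <= Rabs x + Rabs y.
Proof.
replace ((x, y) : C) with (RtoC x + Ci * RtoC y)%C
  by (unfold Ci, RtoC, Cplus, Cmult; simpl; f_equal; ring).
eapply Rle_trans; [apply Cmod_triangle|].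
rewrite Cmod_mult, Cmod_Ci, !Cmod_R; lra.
Qed.

(** Compactness of the disc, in the form of a positive lower bound for the
    sizes of a finite subcover of the enclosing square: around each point [p]
    one attaches a size that is both a radius of control and a lower bound for
    [|h|] within that radius.  Points outside the disc get a size that keeps
    them away from it. *)
Lemma minimum_modulus_pos h R :
  Ccontinuous h -> (forall z, Cmod z <= R -> h z <> RtoC 0) ->
  exists d, 0 < d /\ forall z, Cmod z <= R -> d <= Cmod (h z).
Proof.
intros Hc H0.
assert (loc : forall p : C, exists d : posreal,
  forall z : C, Rabs (fst z - fst p) < d -> Rabs (snd z - snd p) < d ->
  Cmod z <= R -> d <= Cmod (h z)).
{ intros p; destruct (Rle_lt_dec (Cmod p) R) as [Hp|Hp].
  - assert (P : 0 < Cmod (h p)) by (apply Cmod_gt_0, H0, Hp).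
    destruct (Hc p (Cmod (h p) / 2)) as [d [Hd Hd']]; [lra|].
    assert (Q : 0 < Rmin (d / 2) (Cmod (h p) / 2)) by (apply Rmin_pos; lra).
    exists (mkposreal _ Q); simpl; intros z Hx Hy _.
    assert (M1 := Rmin_l (d / 2) (Cmod (h p) / 2)).
    assert (M2 := Rmin_r (d / 2) (Cmod (h p) / 2)).
    assert (D : Cmod (z - p) < d).
    { assert (T := Cmod_le_Re_Im (fst z - fst p) (snd z - snd p)).
      change ((fst z - fst p)%R, (snd z - snd p)%R) with (z - p)%C in T; lra. }
    specialize (Hd' z D).
    assert (T := Cmod_triangle (h p - h z) (h z)).
    replace (h p - h z + h z)%C with (h p) in T by ring.
    rewrite <- Cmod_opp in Hd'.
    replace (- (h z - h p))%C with (h p - h z)%C in Hd' by ring; lra.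
  - assert (Q : 0 < (Cmod p - R) / 2) by lra.
    exists (mkposreal _ Q); simpl; intros z Hx Hy Hz; exfalso.
    assert (T := Cmod_le_Re_Im (fst z - fst p) (snd z - snd p)).
    change ((fst z - fst p)%R, (snd z - snd p)%R) with (z - p)%C in T.
    assert (T2 := Cmod_triangle z (- (z - p))).
    replace (z + - (z - p))%C with p in T2 by ring; rewrite Cmod_opp in T2; lra. }
destruct (functional_choice _ loc) as [delta Hdelta].
destruct (compactness_value_2d (- R) R (- R) R (fun x y => delta (x, y))) as [d Hd].
exists d; split; [apply cond_pos|]; intros z Hz.
assert (B : Rmax (Rabs (fst z)) (Rabs (snd z)) <= R)
  by (eapply Rle_trans; [apply Rmax_Cmod|exact Hz]).
assert (B1 := Rle_trans _ _ _ (Rmax_l _ _) B).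
assert (B2 := Rle_trans _ _ _ (Rmax_r _ _) B).
apply Rabs_le_between in B1; apply Rabs_le_between in B2.
apply NNPP; intros Hn; apply (Hd (fst z) (snd z) B1 B2).
intros [u [v [_ [_ [Hu [Hv Hle]]]]]]; apply Hn.
eapply Rle_trans; [exact Hle|]; now apply Hdelta.
Qed.

Lemma list_max_lt_1 (u : list C) :
  (forall v, In v u -> Cmod v < 1) ->
  exists r, 0 <= r < 1 /\ forall v, In v u -> Cmod v <= r.
Proof.
induction u as [|x u IH]; intros H; [exists 0; split; [lra|easy]|].
destruct IH as [r [Hr Hu]]; [intros; apply H; now right|].
assert (Hx := H x (or_introl eq_refl)).
exists (Rmax r (Cmod x)); split.
- split; [eapply Rle_trans; [|apply Rmax_l]; lra|now apply Rmax_lub_lt].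
- intros v [<-|Hv]; [apply Rmax_r|eapply Rle_trans; [now apply Hu|apply Rmax_l]].
Qed.

Lemma linprod_root u v : In v u -> v <> RtoC 0 -> linprod u (/ v) = RtoC 0.
Proof.
intros Hin Hv; induction u as [|x u IH]; [destruct Hin|].
change ((1 - x * / v) * linprod u (/ v) = 0)%C.
destruct Hin as [->|Hin].
- rewrite Cinv_r by exact Hv; ring.
- rewrite (IH Hin); ring.
Qed.

(** Being zero-free on the closed unit disc forces every reciprocal root to
    have modulus less than 1; as they are finitely many, a single [r < 1]
    bounds them all. *)
Lemma zero_free_polynomial_log_bound q n A z :
  q 0%nat = RtoC 1 -> 0 <= A ->
  (forall w, Cmod w <= 1 -> psum q w n <> RtoC 0) ->
  (forall w, Cmod w = 1 -> ln (Cmod (psum q w n)) <= A) ->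
  Cmod z <= / 2 -> Rabs (ln (Cmod (psum q z n))) <= 4 * A * Cmod z.
Proof.
intros q0 HA Hne HB Hz.
destruct (polynomial_factorisation q n q0) as [u Hu].
destruct (list_max_lt_1 u) as [r [Hr Hur]].
{ intros v Hv; apply Rnot_le_lt; intros Hv1.
  assert (v0 : v <> RtoC 0) by (apply Cmod_gt_0; lra).
  apply (Hne (/ v)%C).
  - rewrite Cmod_inv by exact v0; rewrite <- Rinv_1; apply Rinv_le_contravar; lra.
  - rewrite Hu; now apply linprod_root. }
rewrite Hu; apply (linprod_log_bound u r A z Hur Hr HA); [|exact Hz].
intros w Hw; rewrite <- Hu; now apply HB.
Qed.

Lemma ln_abs_le_iff x c : 0 < x -> Rabs (ln x) <= c <-> exp (- c) <= x <= exp c.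
Proof.
intros Hx; rewrite Rabs_le_between; split; intros [H1 H2].
- split.
  + rewrite <- (exp_ln x Hx); destruct H1 as [H1|H1]; [left; now apply exp_increasing|rewrite H1; lra].
  + rewrite <- (exp_ln x Hx) at 1; destruct H2 as [H2|H2]; [left; now apply exp_increasing|rewrite H2; lra].
- split.
  + rewrite <- (ln_exp (- c)); apply ln_le; [apply exp_pos|exact H1].
  + rewrite <- (ln_exp c); apply ln_le; assumption.
Qed.

(** Cauchy's estimates at radius [2R] give geometrically decaying terms at
    radius [R], so all Taylor polynomials are bounded there without recourse
    to a maximum principle. *)
Lemma entire_le_twice_bound b h R B w n :
  entire_series b h -> 0 < R -> 0 <= B ->
  (forall z, Cmod z = 2 * R -> Cmod (h z) <= B) -> Cmod w <= R ->
  Cmod (psum b w n) <= 2 * B.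
Proof.
intros H HR HB0 HB Hw.
apply Rle_trans with (rsum (fun k => B * (/ 2) ^ k) n).
- apply Cmod_csum_le; intros k _.
  assert (E := entire_cauchy_estimate b h (2 * R) B k H ltac:(lra) HB).
  rewrite Rpow_mult_distr in E; rewrite Cmod_mult, Cmod_pow, pow_inv.
  assert (P : 0 < 2 ^ k) by (apply pow_lt; lra).
  assert (Q : Cmod w ^ k <= R ^ k) by (apply pow_incr; split; [apply Cmod_ge_0|exact Hw]).
  assert (Q2 := Rmult_le_compat_l _ _ _ (Cmod_ge_0 (b k)) Q).
  apply (Rmult_le_reg_r (2 ^ k)); [exact P|].
  rewrite (Rmult_assoc B), Rinv_l by lra.
  assert (Q3 := Rmult_le_compat_r _ _ _ (Rlt_le _ _ P) Q2); lra.
- assert (rsum (fun k => B * (/ 2) ^ k) n = 2 * B * (1 - / 2 * (/ 2) ^ n)).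
  { induction n as [|n IH]; [rewrite rsum_0; simpl; field|].
    rewrite rsum_S, IH; simpl; field. }
  rewrite H0.
  assert (0 < (/ 2) ^ n) by (apply pow_lt; lra).
  assert (0 <= B * (/ 2) ^ n) by (apply Rmult_le_pos; lra). lra.
Qed.

(** The bound holds for every Taylor polynomial close enough to [h] to be
    zero-free on the disc ([minimum_modulus_pos], [entire_uniform]), and
    passes to the limit. *)
Lemma zero_free_log_bound b h R B z :
  entire_series b h -> b 0%nat = RtoC 1 -> 0 < R ->
  (forall w, Cmod w <= R -> h w <> RtoC 0) ->
  (forall w, Cmod w = 2 * R -> Cmod (h w) <= B) ->
  Cmod z <= R / 2 ->
  Rabs (ln (Cmod (h z))) <= 4 * ln (2 * B) * (Cmod z / R).
Proof.
intros H b0 HR Hne HB Hz; pose proof (Cmod_ge_0 z) as Hz0.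
assert (B1 : 1 <= B).
{ assert (E := entire_cauchy_estimate b h (2 * R) B 0 H ltac:(lra) HB).
  rewrite b0, Cmod_1 in E; simpl in E; lra. }
assert (HA : 0 <= ln (2 * B)) by (rewrite <- ln_1; apply ln_le; lra).
destruct (minimum_modulus_pos h R (entire_continuous b h H) Hne) as [d [Hd Hmin]].
set (c := 4 * ln (2 * B) * (Cmod z / R)).
assert (Hz1 : Cmod z <= R) by lra.
assert (Hn : forall eps, 0 < eps -> exists n, Cmod (h z - psum b z n) <= eps /\
   exp (- c) <= Cmod (psum b z n) <= exp c).
{ intros eps He.
  destruct (entire_uniform b h R (Rmin eps (d / 2)) H ltac:(lra)) as [n Happ].
  { apply Rmin_pos; lra. }
  specialize (Happ n (le_n n)).
  assert (Hne' : forall w, Cmod w <= R -> psum b w n <> RtoC 0).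
  { intros w Hw E; specialize (Happ w Hw); rewrite E in Happ.
    replace (h w - 0)%C with (h w) in Happ by ring.
    specialize (Hmin w Hw); assert (M := Rmin_r eps (d / 2)); lra. }
  exists n; split; [eapply Rle_trans; [now apply Happ|apply Rmin_l]|].
  apply ln_abs_le_iff; [apply Cmod_gt_0, Hne', Hz1|].
  assert (R0 : RtoC R <> RtoC 0) by (intros E; apply (f_equal fst) in E; simpl in E; lra).
  assert (Ez : (RtoC R * (z / RtoC R))%C = z) by (field; exact R0).
  assert (Mz : Cmod (z / RtoC R) = Cmod z / R)
    by (rewrite Cmod_div by exact R0; rewrite Cmod_R, Rabs_pos_eq by lra; reflexivity).
  assert (L := zero_free_polynomial_log_bound (fun k => b k * RtoC R ^ k)%C n (ln (2 * B)) (z / RtoC R)).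
  rewrite psum_dilate, Ez, Mz in L; apply L; clear L.
  - rewrite b0; simpl; ring.
  - exact HA.
  - intros w Hw; rewrite psum_dilate; apply Hne'.
    rewrite Cmod_mult, Cmod_R, Rabs_pos_eq by lra; nra.
  - intros w Hw; rewrite psum_dilate.
    assert (Q : Cmod (RtoC R * w) <= R) by (rewrite Cmod_mult, Cmod_R, Rabs_pos_eq, Hw; lra).
    apply ln_le; [apply Cmod_gt_0, Hne', Q|].
    apply (entire_le_twice_bound b h R B); auto; lra.
  - apply Rmult_le_reg_r with R; [exact HR|].
    unfold Rdiv; rewrite Rmult_assoc, Rinv_l; lra. }
apply ln_abs_le_iff; [apply Cmod_gt_0, Hne, Hz1|].
split; apply le_epsilon; intros eps He; destruct (Hn eps He) as [n [Hn1 Hn2]].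
- assert (T := Cmod_triangle (h z) (- (h z - psum b z n))).
  replace (h z + - (h z - psum b z n))%C with (psum b z n) in T by ring.
  rewrite Cmod_opp in T; lra.
- assert (T := Cmod_triangle (psum b z n) (h z - psum b z n)).
  replace (psum b z n + (h z - psum b z n))%C with (h z) in T by ring; lra.
Qed.

(** * Removing roots and the product formula *)

Lemma Ccontinuous_mult h1 h2 :
  Ccontinuous h1 -> Ccontinuous h2 -> Ccontinuous (fun z => h1 z * h2 z)%C.
Proof.
intros H1 H2 z eps He.
set (M := Cmod (h1 z) + Cmod (h2 z) + 1).
pose proof (Cmod_ge_0 (h1 z)); pose proof (Cmod_ge_0 (h2 z)).
assert (HM : 0 < M) by (unfold M; lra).
assert (He' : 0 < Rmin 1 (eps / (2 * M))).
{ apply Rmin_pos; [lra|apply Rdiv_lt_0_compat; lra]. }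
destruct (H1 z _ He') as [d1 [Hd1 K1]]; destruct (H2 z _ He') as [d2 [Hd2 K2]].
exists (Rmin d1 d2); split; [now apply Rmin_pos|]; intros w Hw.
specialize (K1 w (Rlt_le_trans _ _ _ Hw (Rmin_l _ _))).
specialize (K2 w (Rlt_le_trans _ _ _ Hw (Rmin_r _ _))).
assert (L1 := Rmin_l 1 (eps / (2 * M))); assert (L2 := Rmin_r 1 (eps / (2 * M))).
replace (h1 w * h2 w - h1 z * h2 z)%C with
  ((h1 w - h1 z) * h2 z + (h2 w - h2 z) * h1 z + (h1 w - h1 z) * (h2 w - h2 z))%C by ring.
eapply Rle_lt_trans; [apply Cmod_triangle|].
eapply Rle_lt_trans; [apply Rplus_le_compat_r, Cmod_triangle|].
rewrite !Cmod_mult.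
set (m := Rmin 1 (eps / (2 * M))) in *.
pose proof (Cmod_ge_0 (h1 w - h1 z)); pose proof (Cmod_ge_0 (h2 w - h2 z)).
assert (T1 : Cmod (h1 w - h1 z) * Cmod (h2 z) <= m * Cmod (h2 z)) by nra.
assert (T2 : Cmod (h2 w - h2 z) * Cmod (h1 z) <= m * Cmod (h1 z)) by nra.
assert (T3 : Cmod (h1 w - h1 z) * Cmod (h2 w - h2 z) <= m * 1) by nra.
assert (T4 : m * M <= eps / 2).
{ apply Rle_trans with (eps / (2 * M) * M); [apply Rmult_le_compat_r; lra|right; field; lra]. }
unfold M in T4; lra.
Qed.

Lemma Ccontinuous_affine (p q : C) : Ccontinuous (fun z => p + q * z)%C.
Proof.
intros z eps He; pose proof (Cmod_ge_0 q).
exists (eps / (Cmod q + 1)); split; [apply Rdiv_lt_0_compat; lra|]; intros w Hw.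
replace (p + q * w - (p + q * z))%C with (q * (w - z))%C by ring.
rewrite Cmod_mult; pose proof (Cmod_ge_0 (w - z)).
apply Rle_lt_trans with ((Cmod q + 1) * Cmod (w - z)); [nra|].
apply Rmult_lt_reg_r with (/ (Cmod q + 1)); [apply Rinv_0_lt_compat; lra|].
replace ((Cmod q + 1) * Cmod (w - z) * / (Cmod q + 1)) with (Cmod (w - z)) by (field; lra).
exact Hw.
Qed.

Lemma Ccontinuous_ext h1 h2 : (forall z, h1 z = h2 z) -> Ccontinuous h1 -> Ccontinuous h2.
Proof.
intros E H z eps He; destruct (H z eps He) as [d [Hd K]].
exists d; split; [exact Hd|]; intros w Hw; rewrite <- !E; now apply K.
Qed.

Lemma Ccontinuous_power_minus z k : Ccontinuous (fun w => (w - z) ^ k)%C.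
Proof.
induction k as [|k IH].
- apply (Ccontinuous_ext (fun w => 1 + 0 * w)%C); [intros; simpl; ring|apply Ccontinuous_affine].
- apply (Ccontinuous_ext (fun w => (- z + 1 * w) * (w - z) ^ k)%C).
  + intros w; rewrite Cpow_S; ring.
  + apply Ccontinuous_mult; [apply Ccontinuous_affine|exact IH].
Qed.

Lemma Ccontinuous_eq_punctured h1 h2 z :
  Ccontinuous h1 -> Ccontinuous h2 -> (forall w, w <> z -> h1 w = h2 w) -> h1 z = h2 z.
Proof.
intros H1 H2 E.
apply NNPP; intros Hne.
assert (D : 0 < Cmod (h1 z - h2 z)).
{ apply Cmod_gt_0; intros Z; apply Hne.
  replace (h1 z) with ((h1 z - h2 z) + h2 z)%C by ring; rewrite Z; ring. }
set (eps := Cmod (h1 z - h2 z) / 2).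
destruct (H1 z eps) as [d1 [Hd1 K1]]; [unfold eps; lra|].
destruct (H2 z eps) as [d2 [Hd2 K2]]; [unfold eps; lra|].
set (d := Rmin d1 d2 / 2).
assert (Pd := Rmin_pos _ _ Hd1 Hd2).
assert (Md : Cmod (z + RtoC d - z) = d).
{ replace (z + RtoC d - z)%C with (RtoC d) by ring.
  rewrite Cmod_R, Rabs_pos_eq; unfold d; lra. }
assert (L1 := Rmin_l d1 d2); assert (L2 := Rmin_r d1 d2).
specialize (K1 (z + RtoC d)%C ltac:(unfold d in *; lra)).
specialize (K2 (z + RtoC d)%C ltac:(unfold d in *; lra)).
assert (Hw : (z + RtoC d)%C <> z).
{ intros Z; rewrite Z in Md; unfold Cminus in Md; rewrite Cplus_opp_r, Cmod_0 in Md.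
  unfold d in Md; lra. }
rewrite (E _ Hw) in K1.
assert (T := Cmod_triangle (h2 (z + RtoC d)%C - h2 z) (- (h2 (z + RtoC d)%C - h1 z))).
rewrite Cmod_opp in T.
replace (h2 (z + RtoC d)%C - h2 z + - (h2 (z + RtoC d)%C - h1 z))%C with (h1 z - h2 z)%C in T by ring.
unfold eps in *; lra.
Qed.

(** If [f] vanishes to order [m] at [z] and [(w - z)^p] is split off, then by
    continuity the cofactor vanishes at [z] exactly when [p < m].  The power
    [(z - z)^(m - p)] covers both cases: it is 1 for [p = m] and 0
    otherwise. *)
Lemma cofactor_value f g h z m p :
  (forall w, f w = (w - z) ^ m * g w)%C -> (forall w, f w = (w - z) ^ p * h w)%C ->
  Ccontinuous g -> Ccontinuous h -> (p <= m)%nat ->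
  h z = ((z - z) ^ (m - p) * g z)%C.
Proof.
intros Hg Hh Cg Ch Hp.
apply (Ccontinuous_eq_punctured h (fun w => (w - z) ^ (m - p) * g w)%C z Ch).
- apply Ccontinuous_mult; [apply Ccontinuous_power_minus|exact Cg].
- intros w Hw.
  assert (Hwz : (w - z)%C <> RtoC 0).
  { intros Z; apply Hw; replace w with ((w - z) + z)%C by ring; rewrite Z; ring. }
  assert (E := Hg w); rewrite (Hh w) in E.
  replace m with (p + (m - p))%nat in E by lia; rewrite Cpow_add_r in E.
  assert (P := Cpow_nz _ p Hwz).
  replace (h w) with (/ (w - z) ^ p * ((w - z) ^ p * h w))%C by (field; exact P).
  rewrite E; field; exact P.
Qed.

Definition root_prod (lam : nat -> R) (J : list nat) (z : C) : C :=
  linprod (map (fun n => RtoC (- / lam n)) J) z.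

Lemma root_prod_cons lam n J z :
  root_prod lam (n :: J) z = ((1 - RtoC (- / lam n) * z) * root_prod lam J z)%C.
Proof. reflexivity. Qed.

Definition indices_with_root (lam : nat -> R) (y : R) (J : list nat) : list nat :=
  filter (fun j => if Req_dec_T (lam j) y then true else false) J.

Lemma In_indices_with_root lam y J n :
  In n (indices_with_root lam y J) <-> In n J /\ lam n = y.
Proof.
unfold indices_with_root; rewrite filter_In.
destruct (Req_dec_T (lam n) y); intuition discriminate.
Qed.

(** The factors for roots other than [- y] do not vanish at [- y]. *)
Lemma root_prod_cofactor lam y J :
  (forall n, 0 < lam n) ->
  exists T, Ccontinuous T /\ T (RtoC (- y)) <> RtoC 0 /\
    forall w, root_prod lam J w =
      ((w - RtoC (- y)) ^ length (indices_with_root lam y J) * T w)%C.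
Proof.
intros Hlam; induction J as [|n J [T [HT [Hy E]]]].
- exists (fun w => 1 + 0 * w)%C; split; [apply Ccontinuous_affine|split].
  + rewrite Cmult_0_l, Cplus_0_r; apply C1_nz.
  + intros w; unfold root_prod; simpl; ring.
- assert (Hn := Hlam n).
  assert (Pn : RtoC (lam n) <> RtoC 0) by (intros Z; apply (f_equal fst) in Z; simpl in Z; lra).
  assert (RN : RtoC (- / lam n) = (- / RtoC (lam n))%C)
    by (rewrite RtoC_opp, RtoC_inv by lra; reflexivity).
  unfold indices_with_root; simpl; destruct (Req_dec_T (lam n) y) as [Ey|Ey].
  + exists (fun w => (/ RtoC y + 0 * w) * T w)%C; split; [|split].
    * apply Ccontinuous_mult; [apply Ccontinuous_affine|exact HT].
    * apply Cmult_neq_0; [|exact Hy].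
      rewrite Cmult_0_l, Cplus_0_r; intros Z.
      apply C1_nz; rewrite <- (Cinv_r (RtoC y)) by (rewrite <- Ey; exact Pn).
      rewrite Z; ring.
    * intros w; rewrite root_prod_cons, E, RN, <- Ey, RtoC_opp.
      unfold indices_with_root; simpl length.
      rewrite Cpow_S; field; exact Pn.
  + exists (fun w => (1 + - RtoC (- / lam n) * w) * T w)%C; split; [|split].
    * apply Ccontinuous_mult; [apply Ccontinuous_affine|exact HT].
    * apply Cmult_neq_0; [|exact Hy].
      rewrite RN, RtoC_opp; intros Z; apply Ey.
      assert (Z2 : RtoC (lam n) = RtoC y).
      { replace (RtoC y) with (RtoC (lam n) *
          (1 - (1 + - - / RtoC (lam n) * - RtoC y)))%C by (field; exact Pn).
        rewrite Z; ring. }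
      exact (f_equal fst Z2).
    * intros w; rewrite root_prod_cons, E; unfold indices_with_root; ring.
Qed.

Lemma entire_at_0 b h : entire_series b h -> h (RtoC 0) = b 0%nat.
Proof.
intros H; rewrite entire_series_iff in H.
apply (Cseries_unique _ _ _ (H (RtoC 0))).
apply Cseries_iff; intros eps He; exists 0%nat; intros n _.
replace (csum (fun k => b k * RtoC 0 ^ k)%C n) with (b 0%nat).
- unfold Cminus; rewrite Cplus_opp_r, Cmod_0; exact He.
- rewrite (csum_single _ n 0); [simpl; ring|lia|].
  intros [|p] _ Hp; [easy|]; rewrite Cpow_S; ring.
Qed.

Lemma entire_scal (c : C) b h :
  entire_series b h -> entire_series (fun k => c * b k)%C (fun z => c * h z)%C.
Proof.
rewrite !entire_series_iff; intros H z.
apply (is_series_ext (V := C_NormedModule) (fun k => c * (b k * z ^ k))%C).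
- intros k; change ((c * (b k * z ^ k))%C = (c * b k * z ^ k)%C); ring.
- apply (is_series_scal_l (K := C_AbsRing) (V := C_NormedModule) c _ _ (H z)).
Qed.

Lemma root_prod_at_0 lam J : root_prod lam J (RtoC 0) = RtoC 1.
Proof.
induction J as [|n J IH]; [reflexivity|].
rewrite root_prod_cons, IH; ring.
Qed.

Lemma NoDup_indices_with_root lam y J : NoDup J -> NoDup (indices_with_root lam y J).
Proof. apply NoDup_filter. Qed.

(** Splitting off the factors indexed by [J] uses up the multiplicity of the
    root [- y] exactly when [J] contains all indices carrying that root. *)
Lemma cofactor_at_root F lam y J H :
  (forall n, 0 < lam n) -> lists_roots F (fun n => RtoC (- lam n)) ->
  NoDup J -> Ccontinuous H -> (forall w, F w = root_prod lam J w * H w)%C ->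
  (exists n, lam n = y /\ ~ In n J) /\ H (RtoC (- y)) = RtoC 0 \/
  (forall n, lam n = y -> In n J) /\ H (RtoC (- y)) <> RtoC 0.
Proof.
intros Hlam Hroots HJ CH E.
destruct (Hroots (RtoC (- y))) as [l [Hl [Hin [g [[bg Hg] [Hgy Eg]]]]]].
assert (Hin' : forall n, In n l <-> lam n = y).
{ intros n; rewrite Hin; split; intros Z.
  - apply (f_equal fst) in Z; simpl in Z; lra.
  - now rewrite Z. }
destruct (root_prod_cofactor lam y J Hlam) as [T [CT [HT ET]]].
set (J' := indices_with_root lam y J) in *.
assert (Hincl : incl J' l).
{ intros n Hn; apply Hin'; now apply In_indices_with_root in Hn. }
assert (HJ' := NoDup_indices_with_root lam y J HJ : NoDup J').
assert (Hle := NoDup_incl_length HJ' Hincl).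
assert (V := cofactor_value F g (fun w => T w * H w)%C (RtoC (- y)) (length l) (length J')
  Eg ltac:(intros w; rewrite E, ET; ring)
  (entire_continuous bg g Hg) (Ccontinuous_mult _ _ CT CH) Hle).
simpl in V.
destruct (classic (exists n, lam n = y /\ ~ In n J)) as [Hex|Hex].
- left; split; [exact Hex|].
  destruct Hex as [n [Hn HnJ]].
  assert (Hlt : (S (length J') <= length l)%nat).
  { change (length (n :: J') <= length l)%nat; apply NoDup_incl_length.
    - constructor; [|exact HJ']; intros Z; apply HnJ; now apply In_indices_with_root in Z.
    - intros k [<-|Hk]; [now apply Hin'|now apply Hincl]. }
  replace (length l - length J')%nat with (S (length l - S (length J'))) in V by lia.
  rewrite Cpow_S in V.
  destruct (Ceq_dec (H (RtoC (- y))) 0) as [Z|Z]; [exact Z|].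
  exfalso; apply (Cmult_neq_0 _ _ HT Z); rewrite V; ring.
- assert (Hall : forall n, lam n = y -> In n J).
  { intros n Hn; apply NNPP; intros Z; apply Hex; now exists n. }
  right; split; [exact Hall|]; intros Z.
  assert (Hge : (length l <= length J')%nat).
  { apply NoDup_incl_length; [exact Hl|]; intros n Hn; apply Hin' in Hn.
    apply In_indices_with_root; split; [now apply Hall|exact Hn]. }
  replace (length l - length J')%nat with 0%nat in V by lia.
  apply Hgy; rewrite Z in V; simpl in V.
  rewrite Cmult_1_l in V; rewrite <- V; ring.
Qed.

(** While an index remains outside [J], the cofactor still vanishes at the
    corresponding root and can be divided once more. *)
Lemma factor_out_roots c F lam J :
  entire_series c F -> c 0%nat = RtoC 1 -> (forall n, 0 < lam n) ->
  lists_roots F (fun n => RtoC (- lam n)) -> NoDup J ->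
  exists d H, entire_series d H /\ d 0%nat = RtoC 1 /\
    forall w, F w = (root_prod lam J w * H w)%C.
Proof.
intros HF c0 Hlam Hroots HJ.
assert (K : exists d H, entire_series d H /\ forall w, F w = (root_prod lam J w * H w)%C).
{ induction HJ as [|n J Hn HJ [d [H [HH E]]]].
  - exists c, F; split; [exact HF|]; intros w; unfold root_prod; simpl; ring.
  - assert (Hn0 := Hlam n).
    assert (Pn : RtoC (lam n) <> RtoC 0) by (intros Z; apply (f_equal fst) in Z; simpl in Z; lra).
    destruct (entire_divide_root d H (RtoC (- lam n)) HH) as [d' [H' [HH' E']]].
    + intros Z; apply (f_equal fst) in Z; simpl in Z; lra.
    + destruct (cofactor_at_root F lam (lam n) J H Hlam Hroots HJ
        (entire_continuous d H HH) E) as [[_ Z]|[Z _]]; [exact Z|].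
      exfalso; exact (Hn (Z n eq_refl)).
    + exists (fun k => RtoC (lam n) * d' k)%C, (fun w => RtoC (lam n) * H' w)%C.
      split; [now apply entire_scal|]; intros w.
      rewrite E, E', root_prod_cons, !RtoC_opp, RtoC_inv by lra; field; exact Pn. }
destruct K as [d [H [HH E]]]; exists d, H; split; [exact HH|split; [|exact E]].
rewrite <- (entire_at_0 d H HH), <- c0, <- (entire_at_0 c F HF), E, root_prod_at_0; ring.
Qed.

Lemma cofactor_zero_free F lam J H R :
  (forall n, 0 < lam n) -> lists_roots F (fun n => RtoC (- lam n)) ->
  NoDup J -> (forall n, lam n <= R -> In n J) ->
  Ccontinuous H -> (forall w, F w = root_prod lam J w * H w)%C ->
  forall z, Cmod z <= R -> H z <> RtoC 0.
Proof.
intros Hlam Hroots HJ HJR CH E z Hz Z.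
destruct (Hroots z) as [l [Hl [Hin [g [_ [Hgz Eg]]]]]].
destruct l as [|n l].
- apply Hgz; assert (V := Eg z); rewrite (E z), Z in V; simpl in V.
  rewrite Cmult_1_l in V; rewrite <- V; ring.
- assert (Ez := proj1 (Hin n) (or_introl eq_refl)); simpl in Ez; subst z.
  assert (Hn := Hlam n).
  rewrite Cmod_R, Rabs_left in Hz by lra.
  destruct (cofactor_at_root F lam (lam n) J H Hlam Hroots HJ CH E)
    as [[[k [Hk Hk']] _]|[_ V]]; [|exact (V Z)].
  apply Hk', HJR; lra.
Qed.

Lemma root_prod_lower lam J w q R :
  (forall n, 0 < lam n) -> (forall n, In n J -> lam n <= R) ->
  0 <= q -> (q + 1) * R <= Cmod w -> q ^ length J <= Cmod (root_prod lam J w).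
Proof.
intros Hlam HJ Hq Hw; induction J as [|n J IH].
- unfold root_prod; simpl; rewrite Cmod_1; lra.
- rewrite root_prod_cons, Cmod_mult; simpl.
  assert (Hn := Hlam n); assert (HnR := HJ n (or_introl eq_refl)).
  apply Rmult_le_compat; [exact Hq|now apply pow_le| |apply IH; intros; apply HJ; now right].
  assert (T := Cmod_triangle (1 - RtoC (- / lam n) * w) (- (1))).
  replace (1 - RtoC (- / lam n) * w + - (1))%C with (- (RtoC (- / lam n) * w))%C in T by ring.
  rewrite !Cmod_opp, Cmod_mult, Cmod_R, Cmod_1, Rabs_Ropp, Rabs_pos_eq in T
    by (apply Rlt_le, Rinv_0_lt_compat, Hn).
  assert (q + 1 <= / lam n * Cmod w); [|lra].
  apply Rmult_le_reg_l with (lam n); [exact Hn|].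
  rewrite <- Rmult_assoc, Rinv_r, Rmult_1_l by lra.
  eapply Rle_trans; [|exact Hw]; rewrite Rmult_comm; apply Rmult_le_compat_l; lra.
Qed.

Lemma entire_bounded_on_disc b h r :
  entire_series b h -> 0 <= r -> exists B, forall w, Cmod w <= r -> Cmod (h w) <= B.
Proof.
intros H Hr; destruct (entire_abs b h r H Hr) as [s Hs].
exists s; intros w Hw; rewrite entire_series_iff in H.
apply (Cseries_norm_le _ _ _ _ (H w) Hs); intros k.
rewrite Cmod_mult, Cmod_pow; apply Rmult_le_compat_l; [apply Cmod_ge_0|].
apply pow_incr; split; [apply Cmod_ge_0|exact Hw].
Qed.

(** Otherwise duplicate-free lists of every length could be built one element
    at a time. *)
Lemma bounded_listings_finite (P : nat -> Prop) K :
  (forall J, NoDup J -> (forall n, In n J -> P n) -> (length J <= K)%nat) ->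
  exists J, NoDup J /\ forall n, In n J <-> P n.
Proof.
intros HK; apply NNPP; intros Hno.
assert (A : forall k, exists J, NoDup J /\ (forall n, In n J -> P n) /\ length J = k).
{ induction k as [|k [J [HJ [HP Hk]]]].
  - exists nil; split; [constructor|split; [easy|reflexivity]].
  - destruct (classic (exists n, P n /\ ~ In n J)) as [[n [Hn HnJ]]|Hno'].
    + exists (n :: J); split; [now constructor|split; [|simpl; lia]].
      intros m [<-|Hm]; [exact Hn|now apply HP].
    + exfalso; apply Hno; exists J; split; [exact HJ|]; intros n; split; [apply HP|].
      intros Hn; apply NNPP; intros Z; apply Hno'; now exists n. }
destruct (A (S K)) as [J [HJ [HP Hk]]]; specialize (HK J HJ HP); lia.
Qed.

Lemma INR_le_pow2 n : INR n <= 2 ^ n.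
Proof.
induction n as [|n IH]; [simpl; lra|].
rewrite S_INR; simpl; assert (1 <= 2 ^ n) by (apply pow_R1_Rle; lra); lra.
Qed.

(** Jensen's bound in its crudest form: splitting off [N] roots of modulus at
    most [R] divides the maximum on the circle of radius [3R] by at least
    [2^N], while the cofactor still equals 1 at 0, so that its maximum is at
    least 1. *)
Lemma finitely_many_roots c F lam R :
  entire_series c F -> c 0%nat = RtoC 1 -> (forall n, 0 < lam n) ->
  lists_roots F (fun n => RtoC (- lam n)) -> 0 < R ->
  exists J, NoDup J /\ forall n, In n J <-> lam n <= R.
Proof.
intros HF c0 Hlam Hroots HR.
destruct (entire_bounded_on_disc c F (3 * R) HF) as [B HB]; [lra|].
destruct (INR_unbounded B) as [K HK].
apply (bounded_listings_finite _ K); intros J HJ HJR.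
destruct (factor_out_roots c F lam J HF c0 Hlam Hroots HJ) as [d [H [HH [d0 E]]]].
assert (P : 0 < 2 ^ length J) by (apply pow_lt; lra).
assert (Q := entire_cauchy_estimate d H (3 * R) (B / 2 ^ length J) 0 HH ltac:(lra)).
rewrite d0, Cmod_1 in Q; simpl in Q.
assert (Q' : 1 * 1 <= B / 2 ^ length J).
{ apply Q; intros z Hz.
  apply Rmult_le_reg_l with (2 ^ length J); [exact P|].
  replace (2 ^ length J * (B / 2 ^ length J)) with B by (field; lra).
  apply Rle_trans with (Cmod (F z)); [|apply HB; lra].
  rewrite E, Cmod_mult; apply Rmult_le_compat_r; [apply Cmod_ge_0|].
  apply (root_prod_lower lam J z 2 R); auto; lra. }
assert (2 ^ length J <= B).
{ apply Rmult_le_reg_r with (/ 2 ^ length J); [now apply Rinv_0_lt_compat|].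
  rewrite Rinv_r by lra; unfold Rdiv in Q'; lra. }
apply INR_le; pose proof (INR_le_pow2 (length J)); lra.
Qed.

(** At most order one and minimal type: the only consequence of an order less
    than one that enters the product formula. *)
Definition subexponential (F : C -> C) : Prop :=
  forall eps, 0 < eps -> exists R0, forall R, R0 <= R ->
    exists B, (forall w, Cmod w = R -> Cmod (F w) <= B) /\ ln B <= eps * R.

(** The difference of the logarithms is [ln |H(x)|] for the zero-free cofactor
    [H], and the growth hypothesis makes the bound of [zero_free_log_bound]
    tend to zero. *)
Lemma log_root_prod_approx c F lam x eps :
  entire_series c F -> c 0%nat = RtoC 1 -> (forall n, 0 < lam n) ->
  lists_roots F (fun n => RtoC (- lam n)) -> subexponential F ->
  0 < x -> 0 < eps ->
  exists R0, forall R J, R0 <= R -> NoDup J -> (forall n, In n J <-> lam n <= R) ->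
    Rabs (ln (Cmod (F (RtoC x))) - ln (Cmod (root_prod lam J (RtoC x)))) <= eps.
Proof.
intros HF c0 Hlam Hroots Hsub Hx He.
(* The bound is [4 (ln 2 + ln B) x / R], where [ln B] is at most [2 e R] on
   the circle of radius [2R] and [ln 2] at most [2 e R] for large [R]. *)
set (e := eps / (16 * x)).
assert (Pe : 0 < e) by (apply Rdiv_lt_0_compat; lra).
destruct (Hsub e Pe) as [R1 HR1].
exists (Rmax (Rmax 1 (2 * x)) (Rmax R1 (1 / e))); intros R J HR HJ HJR.
assert (M1 := Rmax_l (Rmax 1 (2 * x)) (Rmax R1 (1 / e))).
assert (M2 := Rmax_r (Rmax 1 (2 * x)) (Rmax R1 (1 / e))).
assert (M3 := Rmax_l 1 (2 * x)); assert (M4 := Rmax_r 1 (2 * x)).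
assert (M5 := Rmax_l R1 (1 / e)); assert (M6 := Rmax_r R1 (1 / e)).
destruct (HR1 (2 * R)) as [B [HB HlnB]]; [lra|].
destruct (factor_out_roots c F lam J HF c0 Hlam Hroots HJ) as [d [H [HH [d0 E]]]].
assert (HnzH := cofactor_zero_free F lam J H R Hlam Hroots HJ
  (fun n => proj2 (HJR n)) (entire_continuous d H HH) E).
assert (Low : forall w, 2 * R <= Cmod w -> 1 <= Cmod (root_prod lam J w)).
{ intros w Hw; rewrite <- (pow1 (length J)).
  apply (root_prod_lower lam J w 1 R); [exact Hlam|apply HJR|lra|lra]. }
assert (HBH : forall w, Cmod w = 2 * R -> Cmod (H w) <= B).
{ intros w Hw; apply Rle_trans with (Cmod (F w)); [|now apply HB].
  rewrite E, Cmod_mult; pose proof (Low w ltac:(lra)); pose proof (Cmod_ge_0 (H w)); nra. }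
assert (Mx : Cmod (RtoC x) = x) by (rewrite Cmod_R, Rabs_pos_eq; lra).
assert (Z := zero_free_log_bound d H R B (RtoC x) HH d0 ltac:(lra) HnzH HBH ltac:(lra)).
rewrite Mx in Z.
assert (B1 : 1 <= B).
{ assert (Q := entire_cauchy_estimate d H (2 * R) B 0 HH ltac:(lra) HBH).
  rewrite d0, Cmod_1 in Q; simpl in Q; lra. }
assert (PH : 0 < Cmod (H (RtoC x))) by (apply Cmod_gt_0, HnzH; lra).
assert (PT : 0 < Cmod (root_prod lam J (RtoC x))).
{ apply Cmod_gt_0; clear -Hlam Hx; induction J as [|n J IH]; [apply C1_nz|].
  rewrite root_prod_cons; apply Cmult_neq_0; [|exact IH].
  assert (Hn := Rinv_0_lt_compat _ (Hlam n)).
  intros Z; apply (f_equal fst) in Z; simpl in Z; nra. }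
rewrite E, Cmod_mult, ln_mult by assumption.
replace (ln (Cmod (root_prod lam J (RtoC x))) + ln (Cmod (H (RtoC x))) -
  ln (Cmod (root_prod lam J (RtoC x)))) with (ln (Cmod (H (RtoC x)))) by ring.
eapply Rle_trans; [exact Z|].
rewrite ln_mult by lra.
assert (L2 : ln 2 <= 1) by (rewrite <- (ln_exp 1); apply ln_le; [lra|]; pose proof (exp_ineq1 1 ltac:(lra)); lra).
assert (HeR : 1 <= e * R).
{ apply Rle_trans with (e * (1 / e)); [right; field; lra|apply Rmult_le_compat_l; lra]. }
apply Rle_trans with (4 * (4 * (e * R)) * (x / R)).
- apply Rmult_le_compat_r; [apply Rlt_le, Rdiv_lt_0_compat; lra|lra].
- right; unfold e; field; lra.
Qed.

Definition list_sum_of (t : nat -> R) (J : list nat) : R :=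
  fold_right (fun n s => t n + s) 0 J.

Lemma list_sum_of_incl t J J' :
  (forall n, 0 <= t n) -> NoDup J -> incl J J' -> list_sum_of t J <= list_sum_of t J'.
Proof.
intros Ht HJ; revert J'; induction HJ as [|n J Hn HJ IH]; intros J' Hi.
- simpl; clear Hi; induction J' as [|m J' IH]; simpl; [lra|specialize (Ht m); lra].
- destruct (in_split n J' (Hi n (or_introl eq_refl))) as [l1 [l2 ->]].
  assert (Hi' : incl J (l1 ++ l2)).
  { intros m Hm; assert (Hm' := Hi m (or_intror Hm)).
    apply in_app_iff in Hm'; apply in_app_iff; destruct Hm' as [|[<-|]]; auto; contradiction. }
  specialize (IH _ Hi').
  assert (E : list_sum_of t (l1 ++ n :: l2) = t n + list_sum_of t (l1 ++ l2)).
  { clear; induction l1 as [|m l1 IH]; simpl; [reflexivity|rewrite IH; ring]. }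
  rewrite E; simpl; lra.
Qed.

Lemma list_sum_of_seq t N : list_sum_of t (seq 0 (S N)) = rsum t N.
Proof.
assert (A : forall l m, list_sum_of t (l ++ m :: nil) = list_sum_of t l + t m).
{ induction l as [|k l IH]; intros m; simpl; [ring|rewrite IH; ring]. }
induction N as [|N IH]; [rewrite rsum_0; simpl; ring|].
rewrite seq_S, A, IH, rsum_S; reflexivity.
Qed.

Lemma ln_root_prod lam J x :
  (forall n, 0 < lam n) -> 0 < x ->
  ln (Cmod (root_prod lam J (RtoC x))) = list_sum_of (fun n => ln (1 + x / lam n)) J.
Proof.
intros Hlam Hx.
assert (E : root_prod lam J (RtoC x) = RtoC (exp (list_sum_of (fun n => ln (1 + x / lam n)) J))).
{ induction J as [|n J IH]; [simpl; rewrite exp_0; reflexivity|].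
  rewrite root_prod_cons, IH; simpl.
  assert (Hn := Rdiv_lt_0_compat _ _ Hx (Hlam n)).
  rewrite exp_plus, exp_ln by lra.
  rewrite RtoC_mult; f_equal.
  unfold Cminus, Cplus, Cmult, Copp, RtoC; simpl; f_equal; unfold Rdiv; ring. }
rewrite E, Cmod_R, Rabs_pos_eq by apply Rlt_le, exp_pos; apply ln_exp.
Qed.

Lemma exists_upper_bound (lam : nat -> R) N : exists R, forall n, (n <= N)%nat -> lam n <= R.
Proof.
induction N as [|N [R HR]].
- exists (lam 0%nat); intros n Hn; replace n with 0%nat by lia; lra.
- exists (Rmax R (lam (S N))); intros n Hn.
  destruct (Nat.eq_dec n (S N)) as [->|]; [apply Rmax_r|].
  eapply Rle_trans; [apply HR; lia|apply Rmax_l].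
Qed.

(** The roots need not be listed by increasing modulus.  Since all terms are
    nonnegative, partial sums lie between the sums over the roots of modulus
    at most [R] for a small and for a large [R], and these converge. *)
Theorem hadamard_product_log c F lam x :
  entire_series c F -> c 0%nat = RtoC 1 -> (forall n, 0 < lam n) ->
  lists_roots F (fun n => RtoC (- lam n)) -> subexponential F -> 0 < x ->
  is_series (fun n => ln (1 + x / lam n)) (ln (Cmod (F (RtoC x)))).
Proof.
intros HF c0 Hlam Hroots Hsub Hx.
set (t := fun n => ln (1 + x / lam n)).
assert (Ht : forall n, 0 <= t n).
{ intros n; assert (Hn := Rdiv_lt_0_compat _ _ Hx (Hlam n)).
  unfold t; rewrite <- ln_1; apply ln_le; lra. }
set (L := ln (Cmod (F (RtoC x)))).
assert (Happ : forall eps, 0 < eps -> exists R0, forall R, R0 <= R ->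
   exists J, NoDup J /\ (forall n, In n J <-> lam n <= R) /\ Rabs (L - list_sum_of t J) <= eps).
{ intros eps He.
  destruct (log_root_prod_approx c F lam x eps HF c0 Hlam Hroots Hsub Hx He) as [R0 HR0].
  exists (Rmax R0 1); intros R HR.
  assert (M1 := Rmax_l R0 1); assert (M2 := Rmax_r R0 1).
  destruct (finitely_many_roots c F lam R HF c0 Hlam Hroots) as [J [HJ HJR]]; [lra|].
  exists J; split; [exact HJ|split; [exact HJR|]].
  unfold t; rewrite <- ln_root_prod by assumption; apply (HR0 R); [lra|assumption|assumption]. }
apply Rseries_iff; intros eps He.
destruct (Happ (eps / 2)) as [R0 HR0]; [lra|].
destruct (HR0 R0 (Rle_refl _)) as [J [HJ [HJR HL]]].
exists (list_max J); intros n Hn.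
assert (Low : list_sum_of t J <= rsum t n).
{ rewrite <- list_sum_of_seq; apply list_sum_of_incl; [exact Ht|exact HJ|].
  intros k Hk; apply in_seq.
  assert (B := proj1 (list_max_le J (list_max J)) (le_n _)).
  rewrite Forall_forall in B; specialize (B k Hk); lia. }
assert (Up : rsum t n <= L + eps / 2).
{ destruct (exists_upper_bound lam n) as [R1 HR1].
  destruct (HR0 (Rmax R0 R1) (Rmax_l _ _)) as [J1 [HJ1 [HJR1 HL1]]].
  apply Rabs_le_between in HL1.
  assert (rsum t n <= list_sum_of t J1); [|lra].
  rewrite <- list_sum_of_seq; apply list_sum_of_incl; [exact Ht|apply seq_NoDup|].
  intros k Hk; apply in_seq in Hk; apply HJR1.
  eapply Rle_trans; [apply HR1; lia|apply Rmax_r]. }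
apply Rabs_le_between in HL; apply Rabs_def1; lra.
Qed.

(** * Sums of Stieltjes kernels *)

Lemma Series_nonneg (t : nat -> R) :
  (forall n, 0 <= t n) -> ex_series t -> 0 <= Series t.
Proof.
intros Ht Hs.
assert (Z : is_series (fun _ : nat => 0) 0).
{ apply Rseries_iff; intros eps He; exists 0%nat; intros n _.
  rewrite rsum_const, Rmult_0_r, Rminus_0_r, Rabs_R0; exact He. }
rewrite <- (is_series_unique _ _ Z); apply Series_le; [intros n; split; [lra|apply Ht]|exact Hs].
Qed.

Lemma ex_series_mult_const c (t : nat -> R) : ex_series t -> ex_series (fun n => c * t n).
Proof. intros Ht; exact (ex_series_scal_l c t Ht). Qed.

(** A summable bound on second derivatives controls the errors of all
    first-order Taylor expansions simultaneously by a multiple of [h^2]. *)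
Lemma Series_termwise_derive (u du ddu : nat -> R -> R) (K : nat -> R) x d :
  0 < d ->
  (forall y, Rabs (y - x) < d -> ex_series (fun n => u n y)) ->
  ex_series (fun n => du n x) -> ex_series K ->
  (forall n y, Rabs (y - x) < d ->
     is_derive (u n) y (du n y) /\ is_derive (du n) y (ddu n y) /\ Rabs (ddu n y) <= K n) ->
  is_derive (fun y => Series (fun n => u n y)) x (Series (fun n => du n x)).
Proof.
intros Hd Hu Hdu HK Hder.
assert (taylor : forall n y, Rabs (y - x) < d ->
  Rabs (u n y - u n x - du n x * (y - x)) <= K n * Rabs (y - x) ^ 2).
{ intros n y Hy.
  assert (near : forall c, Rmin x y <= c <= Rmax x y -> Rabs (c - x) <= Rabs (y - x)).
  { intros c; unfold Rmin, Rmax; destruct (Rle_dec x y) as [Hxy|Hxy]; intros Hc;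
    unfold Rabs; destruct (Rcase_abs (c - x)); destruct (Rcase_abs (y - x)); lra. }
  destruct (MVT_gen (u n) x y (du n)) as [c [Hc E]].
  - intros c Hc; apply Hder; eapply Rle_lt_trans; [apply near; lra|exact Hy].
  - intros c Hc; apply continuity_pt_filterlim, (ex_derive_continuous (u n)).
    exists (du n c); apply Hder; eapply Rle_lt_trans; [now apply near|exact Hy].
  - assert (Hcx := near c Hc).
    assert (near' : forall e, Rmin x c <= e <= Rmax x c -> Rabs (e - x) < d).
    { intros e He; apply Rle_lt_trans with (Rabs (c - x)); [|lra].
      revert He; unfold Rmin, Rmax; destruct (Rle_dec x c); intros He;
      unfold Rabs; destruct (Rcase_abs (e - x)); destruct (Rcase_abs (c - x)); lra. }
    destruct (MVT_gen (du n) x c (ddu n)) as [e [He E']].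
    + intros e He; apply Hder, near'; lra.
    + intros e He; apply continuity_pt_filterlim, (ex_derive_continuous (du n)).
      exists (ddu n e); apply Hder, near'; exact He.
    + rewrite E.
      replace (du n c * (y - x) - du n x * (y - x)) with ((du n c - du n x) * (y - x)) by ring.
      rewrite E', !Rabs_mult.
      destruct (Hder n e (near' e He)) as [_ [_ B]].
      pose proof (Rabs_pos (ddu n e)); pose proof (Rabs_pos (c - x)); pose proof (Rabs_pos (y - x)).
      assert (Rabs (ddu n e) * Rabs (c - x) <= K n * Rabs (y - x))
        by (apply Rmult_le_compat; assumption).
      simpl; nra. }
assert (HxD : Rabs (x - x) < d) by (rewrite Rminus_eq_0, Rabs_R0; exact Hd).
assert (K0 : forall n, 0 <= K n).
{ intros n; destruct (Hder n x HxD) as [_ [_ B]]; pose proof (Rabs_pos (ddu n x)); lra. }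
set (SK := Series K).
assert (SK0 : 0 <= SK).
{ now apply Series_nonneg. }
apply is_derive_Reals; intros eps He.
assert (Pm : 0 < Rmin d (eps / (SK + 1))) by (apply Rmin_pos; [exact Hd|apply Rdiv_lt_0_compat; lra]).
exists (mkposreal _ Pm); intros h Hh0 Hh; simpl in Hh.
assert (Hh1 := Rlt_le_trans _ _ _ Hh (Rmin_l _ _)).
assert (Hh2 := Rlt_le_trans _ _ _ Hh (Rmin_r _ _)).
assert (Eh : x + h - x = h) by ring.
assert (Hy : Rabs (x + h - x) < d) by now rewrite Eh.
assert (Sy := Hu _ Hy); assert (Sx := Hu _ HxD).
assert (Sd := ex_series_scal_r h _ Hdu).
assert (E : Series (fun n => u n (x + h)) - Series (fun n => u n x) - Series (fun n => du n x) * h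
  = Series (fun n => u n (x + h) - u n x - du n x * h)).
{ rewrite <- Series_scal_r, <- Series_minus by assumption.
  rewrite <- Series_minus; [reflexivity| |assumption].
  now apply (ex_series_minus (V := R_NormedModule)). }
assert (B : Rabs (Series (fun n => u n (x + h)) - Series (fun n => u n x) - Series (fun n => du n x) * h)
  <= SK * Rabs h ^ 2).
{ rewrite E; unfold SK; rewrite <- Series_scal_r.
  assert (T : forall n, 0 <= Rabs (u n (x + h) - u n x - du n x * h) <= K n * Rabs h ^ 2).
  { intros n; split; [apply Rabs_pos|].
    assert (T := taylor n _ Hy); now rewrite Eh in T. }
  assert (Sk := ex_series_scal_r (Rabs h ^ 2) _ HK).
  eapply Rle_trans; [apply Series_Rabs|apply Series_le; [exact T|exact Sk]].
  apply (ex_series_le (V := R_CompleteNormedModule) _ (fun n => K n * Rabs h ^ 2)); [|exact Sk].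
  intros n; change (Rabs (Rabs (u n (x + h) - u n x - du n x * h)) <= K n * Rabs h ^ 2).
  rewrite Rabs_Rabsolu; apply T. }
assert (Ph : 0 < Rabs h) by now apply Rabs_pos_lt.
replace ((Series (fun n => u n (x + h)) - Series (fun n => u n x)) / h - Series (fun n => du n x))
  with ((Series (fun n => u n (x + h)) - Series (fun n => u n x) - Series (fun n => du n x) * h) * / h)
  by (field; exact Hh0).
rewrite Rabs_mult, Rabs_inv.
apply Rmult_lt_reg_r with (Rabs h); [exact Ph|].
rewrite Rmult_assoc, Rinv_l, Rmult_1_r by lra.
eapply Rle_lt_trans; [exact B|].
assert (Q : (SK + 1) * Rabs h < eps).
{ apply Rmult_lt_reg_r with (/ (SK + 1)); [apply Rinv_0_lt_compat; lra|].
  replace ((SK + 1) * Rabs h * / (SK + 1)) with (Rabs h) by (field; lra); exact Hh2. }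
simpl; nra.
Qed.

Definition inverse_power (lam : nat -> R) (k p n : nat) (x : R) : R :=
  lam n ^ k / (x + lam n) ^ p.

(** The sums in which all derivatives are expressed: derivation raises [p],
    and multiplication by [x] mixes [k] and [k + 1]. *)
Definition stieltjes_sum (lam : nat -> R) (k p : nat) (x : R) : R :=
  Series (fun n => inverse_power lam k p n x).

Lemma is_derive_inverse_power lam k p n x :
  0 < x + lam n ->
  is_derive (inverse_power lam k p n) x (- INR p * inverse_power lam k (S p) n x).
Proof.
intros Hx; unfold inverse_power.
assert (P : (x + lam n) ^ p <> 0) by (apply pow_nonzero; lra).
assert (D1 : is_derive (fun x => x + lam n) x 1).
{ auto_derive; [exact I|ring]. }
assert (D2 := is_derive_pow (fun x => x + lam n) p x 1 D1).
assert (D3 := is_derive_scal _ _ (lam n ^ k) _ (is_derive_inv _ _ _ D2 P)).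
match type of D3 with is_derive _ _ ?l =>
  replace (- INR p * (lam n ^ k / (x + lam n) ^ S p)) with l end; [exact D3|].
destruct p as [|p]; [simpl; field; lra|].
simpl Init.Nat.pred; set (N := INR (S p)).
assert (P' : (x + lam n) ^ p <> 0) by (apply pow_nonzero; lra).
simpl; field; split; [exact P'|lra].
Qed.

(** For [p > k] the summand is at most a locally bounded multiple of [1 / lam
    n]; this is the majorant for all termwise differentiations. *)
Lemma inverse_power_bound lam k m n x :
  0 < lam n -> 0 < x -> 0 <= inverse_power lam k (S k + m) n x <= (/ x) ^ m * / lam n.
Proof.
intros Hl Hx; unfold inverse_power.
assert (P : 0 < (x + lam n) ^ (S k + m)) by (apply pow_lt; lra).
assert (P1 : 0 < lam n ^ k) by (apply pow_lt; lra).
split; [apply Rlt_le, Rdiv_lt_0_compat; assumption|].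
rewrite pow_add; simpl.
assert (P2 : 0 < x ^ m) by (apply pow_lt; lra).
assert (Q1 : x ^ m <= (x + lam n) ^ m) by (apply pow_incr; lra).
assert (Q2 : lam n ^ k <= (x + lam n) ^ k) by (apply pow_incr; lra).
assert (Q3 : 0 < (x + lam n) ^ k) by (apply pow_lt; lra).
assert (Q4 : 0 < (x + lam n) ^ m) by (apply pow_lt; lra).
rewrite pow_inv.
apply Rmult_le_reg_r with ((x + lam n) * (x + lam n) ^ k * (x + lam n) ^ m);
  [repeat apply Rmult_lt_0_compat; lra|].
unfold Rdiv; rewrite Rmult_assoc, Rinv_l, Rmult_1_r
  by (apply Rgt_not_eq; repeat apply Rmult_lt_0_compat; lra).
apply Rmult_le_reg_r with (x ^ m * lam n); [now apply Rmult_lt_0_compat|].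
replace (/ x ^ m * / lam n * ((x + lam n) * (x + lam n) ^ k * (x + lam n) ^ m) * (x ^ m * lam n))
  with ((x + lam n) * (x + lam n) ^ k * (x + lam n) ^ m) by (field; lra).
replace (lam n ^ k * (x ^ m * lam n)) with (lam n * lam n ^ k * x ^ m) by ring.
apply Rmult_le_compat; [apply Rmult_le_pos; lra|lra| |exact Q1].
apply Rmult_le_compat; lra.
Qed.

Lemma ex_series_inverse_power lam k p x :
  (forall n, 0 < lam n) -> ex_series (fun n => / lam n) -> (k < p)%nat -> 0 < x ->
  ex_series (fun n => inverse_power lam k p n x).
Proof.
intros Hl Hs Hkp Hx.
apply (ex_series_le (V := R_CompleteNormedModule) _ (fun n => (/ x) ^ (p - S k) * / lam n)).
- intros n; change (Rabs (inverse_power lam k p n x) <= (/ x) ^ (p - S k) * / lam n).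
  replace p with (S k + (p - S k))%nat at 1 by lia.
  destruct (inverse_power_bound lam k (p - S k) n x (Hl n) Hx) as [B1 B2].
  rewrite Rabs_pos_eq; assumption.
- now apply ex_series_mult_const.
Qed.

Lemma near_half x y : Rabs (y - x) < x / 2 -> x / 2 < y.
Proof. intros H; apply Rabs_def2 in H; lra. Qed.

Lemma is_derive_stieltjes_sum lam k p x :
  (forall n, 0 < lam n) -> ex_series (fun n => / lam n) -> (k < p)%nat -> 0 < x ->
  is_derive (stieltjes_sum lam k p) x (- INR p * stieltjes_sum lam k (S p) x).
Proof.
intros Hl Hs Hkp Hx; unfold stieltjes_sum at 2; rewrite <- Series_scal_l.
set (K := fun n => INR p * INR (S p) * (/ (x / 2)) ^ (S (S p) - S k) * / lam n).
apply (Series_termwise_derive (fun n => inverse_power lam k p n)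
  (fun n y => - INR p * inverse_power lam k (S p) n y)
  (fun n y => - INR p * (- INR (S p) * inverse_power lam k (S (S p)) n y)) K x (x / 2)); [lra| | | |].
- intros y Hy; apply ex_series_inverse_power; auto; apply near_half in Hy; lra.
- apply ex_series_mult_const, ex_series_inverse_power; auto.
- now apply ex_series_mult_const.
- intros n y Hy; apply near_half in Hy; assert (Hn := Hl n).
  split; [apply is_derive_inverse_power; lra|split].
  + apply (is_derive_scal (inverse_power lam k (S p) n)), is_derive_inverse_power; lra.
  + destruct (inverse_power_bound lam k (S (S p) - S k) n y Hn) as [B1 B2]; [lra|].
    replace (S k + (S (S p) - S k))%nat with (S (S p)) in B1, B2 by lia.
    pose proof (pos_INR p); pose proof (pos_INR (S p)).
    set (m := (S (S p) - S k)%nat) in *.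
    assert (B3 : (/ y) ^ m <= (/ (x / 2)) ^ m).
    { apply pow_incr; split; [apply Rlt_le, Rinv_0_lt_compat; lra|].
      apply Rinv_le_contravar; lra. }
    assert (B4 := Rinv_0_lt_compat _ Hn).
    unfold K; fold m.
    rewrite Rabs_pos_eq; [|apply Rle_trans with (INR p * INR (S p) * inverse_power lam k (S (S p)) n y);
      [apply Rmult_le_pos; [nra|assumption]|right; ring]].
    replace (- INR p * (- INR (S p) * inverse_power lam k (S (S p)) n y))
     with (INR p * INR (S p) * inverse_power lam k (S (S p)) n y) by ring.
    rewrite (Rmult_assoc (INR p * INR (S p))).
    apply Rmult_le_compat_l; [nra|].
    eapply Rle_trans; [exact B2|]; apply Rmult_le_compat_r; lra.
Qed.

Lemma is_derive_log_product lam x :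
  (forall n, 0 < lam n) -> ex_series (fun n => / lam n) ->
  (forall y, 0 < y -> ex_series (fun n => ln (1 + y / lam n))) -> 0 < x ->
  is_derive (fun y => Series (fun n => ln (1 + y / lam n))) x (stieltjes_sum lam 0 1 x).
Proof.
intros Hl Hs Hln Hx.
set (K := fun n => (/ (x / 2)) ^ 1 * / lam n).
apply (Series_termwise_derive (fun n y => ln (1 + y / lam n))
  (inverse_power lam 0 1) (fun n y => - INR 1 * inverse_power lam 0 2 n y) K x (x / 2)); [lra| | | |].
- intros y Hy; apply Hln; apply near_half in Hy; lra.
- apply ex_series_inverse_power; auto.
- now apply ex_series_mult_const.
- intros n y Hy; apply near_half in Hy; assert (Hn := Hl n).
  split; [|split; [apply (is_derive_inverse_power lam 0 1 n y); lra|]].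
  + assert (Q : 0 < y / lam n) by (apply Rdiv_lt_0_compat; lra).
    unfold inverse_power; auto_derive; [unfold Rdiv in Q; lra|].
    simpl; field; split; [lra|]; lra.
  + destruct (inverse_power_bound lam 0 1 n y Hn) as [B1 B2]; [lra|].
    change (1 + 1)%nat with 2%nat in B1, B2.
    change (INR 1) with 1; rewrite Rabs_left1 by lra; unfold K.
    assert (B3 : (/ y) ^ 1 <= (/ (x / 2)) ^ 1).
    { apply pow_incr; split; [apply Rlt_le, Rinv_0_lt_compat; lra|].
      apply Rinv_le_contravar; lra. }
    assert (B4 := Rinv_0_lt_compat _ Hn).
    assert ((/ y) ^ 1 * / lam n <= (/ (x / 2)) ^ 1 * / lam n) by (apply Rmult_le_compat_r; lra).
    lra.
Qed.

(** The elementary inequality [1 + sum u_n <= prod (1 + u_n)]. *)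
Lemma ex_series_inv_of_log lam :
  (forall n, 0 < lam n) -> ex_series (fun n => ln (1 + 1 / lam n)) -> ex_series (fun n => / lam n).
Proof.
intros Hl [L HL].
assert (Hi : forall n, 0 < / lam n) by (intros; now apply Rinv_0_lt_compat).
assert (Hpos : forall n, 0 <= ln (1 + 1 / lam n)).
{ intros n; specialize (Hi n); rewrite <- ln_1; apply ln_le; unfold Rdiv; lra. }
assert (B : forall n, 1 + rsum (fun n => / lam n) n <= exp (rsum (fun n => ln (1 + 1 / lam n)) n)).
{ induction n as [|n IH].
  - rewrite !rsum_0, exp_ln; [unfold Rdiv; lra|specialize (Hi 0%nat); unfold Rdiv; lra].
  - rewrite !rsum_S, exp_plus, exp_ln by (specialize (Hi (S n)); unfold Rdiv; lra).
    assert (0 <= rsum (fun n => / lam n) n).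
    { apply Rle_trans with (rsum (fun _ => 0) n); [rewrite rsum_const; lra|].
      apply rsum_le; intros k _; specialize (Hi k); lra. }
    specialize (Hi (S n)); unfold Rdiv; nra. }
assert (M : forall n, rsum (fun n => ln (1 + 1 / lam n)) n <= L).
{ intros n.
  assert (T : is_lim_seq (rsum (fun n => ln (1 + 1 / lam n))) L) by exact HL.
  apply (is_lim_seq_incr_compare _ _ T); intros m; rewrite rsum_S; specialize (Hpos (S m)); lra. }
apply (ex_finite_lim_seq_incr (rsum (fun n => / lam n)) (exp L)).
- intros n; change (rsum (fun n => / lam n) n <= rsum (fun n => / lam n) (S n)).
  rewrite rsum_S; specialize (Hi (S n)); lra.
- intros n; change (rsum (fun n => / lam n) n <= exp L).
  specialize (B n); specialize (M n).
  assert (exp (rsum (fun n => ln (1 + 1 / lam n)) n) <= exp L)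
    by (destruct M as [M| ->]; [left; now apply exp_increasing|lra]).
  lra.
Qed.

Lemma stieltjes_sum_shift lam k p x :
  (forall n, 0 < lam n) -> ex_series (fun n => / lam n) -> (k < p)%nat -> 0 < x ->
  stieltjes_sum lam (S k) (S p) x = stieltjes_sum lam k p x - x * stieltjes_sum lam k (S p) x.
Proof.
intros Hl Hs Hkp Hx; unfold stieltjes_sum.
rewrite <- Series_scal_l, <- Series_minus.
- apply Series_ext; intros n; unfold inverse_power; assert (Hn := Hl n).
  assert ((x + lam n) ^ p <> 0) by (apply pow_nonzero; lra).
  simpl; field; split; [assumption|lra].
- now apply ex_series_inverse_power.
- apply ex_series_mult_const, ex_series_inverse_power; auto.
Qed.

Lemma stieltjes_sum_pos lam k p x :
  (forall n, 0 < lam n) -> ex_series (fun n => / lam n) -> (k < p)%nat -> 0 < x ->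
  0 <= stieltjes_sum lam k p x.
Proof.
intros Hl Hs Hkp Hx; unfold stieltjes_sum.
apply Series_nonneg; [|now apply ex_series_inverse_power].
intros n.
replace p with (S k + (p - S k))%nat by lia; now apply inverse_power_bound.
Qed.

(** * Iterated derivatives on the positive half-line *)

Lemma locally_pos (P : R -> Prop) x : (forall y, 0 < y -> P y) -> 0 < x -> locally x P.
Proof.
intros H Hx; exists (mkposreal x Hx); intros y Hy; apply H.
change (Rabs (y - x) < x) in Hy; apply Rabs_def2 in Hy; lra.
Qed.

Lemma is_derive_ext_pos (f g : R -> R) (l x : R) :
  (forall y, 0 < y -> f y = g y) -> 0 < x -> is_derive f x l -> is_derive g x l.
Proof. intros H Hx; apply is_derive_ext_loc; now apply (locally_pos (fun y => f y = g y)). Qed.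

Lemma Derive_n_ext_pos f g j x :
  (forall y, 0 < y -> f y = g y) -> 0 < x -> Derive_n f j x = Derive_n g j x.
Proof. intros H Hx; apply Derive_n_ext_loc; now apply (locally_pos (fun y => f y = g y)). Qed.

Lemma ex_derive_n_ext_pos f g j x :
  (forall y, 0 < y -> f y = g y) -> 0 < x -> ex_derive_n f j x -> ex_derive_n g j x.
Proof. intros H Hx; apply ex_derive_n_ext_loc; now apply (locally_pos (fun y => f y = g y)). Qed.

Definition smooth_pos (y : R -> R) : Prop := forall j x, 0 < x -> ex_derive_n y j x.

(** Leibniz's formula for [t * y], whose first factor has vanishing second
    derivative. *)
Lemma Derive_n_mult_id y j x :
  smooth_pos y -> 0 < x ->
  is_derive (Derive_n (fun t => t * y t) j) x
    (x * Derive_n y (S j) x + INR (S j) * Derive_n y j x).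
Proof.
intros Hy; revert x; induction j as [|j IH]; intros x Hx.
- simpl; rewrite Rmult_1_l.
  assert (D := Derive_correct _ _ (Hy 1%nat x Hx)).
  assert (D2 := is_derive_mult (fun t => t) y x _ _ (is_derive_id (K := R_AbsRing) x) D Rmult_comm).
  match type of D2 with is_derive _ _ ?l => replace (x * Derive (fun x => y x) x + y x) with l end;
    [exact D2|].
  unfold plus, mult, one; simpl; change (fun x0 => y x0) with y; ring.
- apply (is_derive_ext_pos (fun t => t * Derive_n y (S j) t + INR (S j) * Derive_n y j t));
    [intros t Ht; symmetry; apply is_derive_unique, IH, Ht|exact Hx|].
  assert (D1 := Derive_correct _ _ (Hy (S (S j)) x Hx)).
  assert (D0 := Derive_correct _ _ (Hy (S j) x Hx)).
  assert (D2 := is_derive_plus _ _ x _ _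
    (is_derive_mult (fun t => t) (Derive_n y (S j)) x _ _ (is_derive_id (K := R_AbsRing) x) D1 Rmult_comm)
    (is_derive_scal (Derive_n y j) x (INR (S j)) _ D0)).
  match type of D2 with is_derive _ _ ?l =>
    replace (x * Derive_n y (S (S j)) x + INR (S (S j)) * Derive_n y (S j) x) with l end; [exact D2|].
  rewrite (S_INR (S j)); unfold plus, mult, one; simpl plus; simpl Derive_n.
  change (1 * Derive (Derive_n y j) x + x * Derive (fun x => Derive_n y (S j) x) x
    + INR (S j) * Derive (Derive_n y j) x
   = x * Derive (Derive_n y (S j)) x + (INR (S j) + 1) * Derive (Derive_n y j) x).
  change (fun x => Derive_n y (S j) x) with (Derive_n y (S j)); ring.
Qed.

Lemma smooth_pos_mult_id y : smooth_pos y -> smooth_pos (fun t => t * y t).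
Proof.
intros Hy [|j] x Hx; [exact I|].
eexists; now apply Derive_n_mult_id.
Qed.

Lemma smooth_pos_mult_pow y p : smooth_pos y -> smooth_pos (fun t => t ^ p * y t).
Proof.
intros Hy; induction p as [|p IH]; intros j x Hx.
- apply (ex_derive_n_ext_pos y); [intros; simpl; ring|exact Hx|now apply Hy].
- apply (ex_derive_n_ext_pos (fun t => t * (t ^ p * y t))); [intros; simpl; ring|exact Hx|].
  now apply smooth_pos_mult_id.
Qed.

Fixpoint rising (p j : nat) : R :=
  match j with O => 1 | S i => rising p i * INR (p + i) end.

Lemma rising_nonneg p j : 0 <= rising p j.
Proof.
induction j as [|j IH]; simpl; [lra|]; apply Rmult_le_pos; [exact IH|apply pos_INR].
Qed.

Lemma Derive_n_stieltjes_sum lam c k p j x :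
  (forall n, 0 < lam n) -> ex_series (fun n => / lam n) -> (k < p)%nat -> 0 < x ->
  is_derive (Derive_n (fun t => c * stieltjes_sum lam k p t) j) x
    (c * (-1) ^ S j * rising p (S j) * stieltjes_sum lam k (p + S j) x) /\
  Derive_n (fun t => c * stieltjes_sum lam k p t) j x =
    c * (-1) ^ j * rising p j * stieltjes_sum lam k (p + j) x.
Proof.
intros Hl Hs Hkp.
assert (D : forall q a x, (k < q)%nat -> 0 < x ->
  is_derive (fun t => a * stieltjes_sum lam k q t) x (- a * INR q * stieltjes_sum lam k (S q) x)).
{ intros q a t Hq Ht.
  replace (- a * INR q * stieltjes_sum lam k (S q) t)
    with (a * (- INR q * stieltjes_sum lam k (S q) t)) by ring.
  apply (is_derive_scal (stieltjes_sum lam k q)).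
  now apply is_derive_stieltjes_sum. }
assert (step : forall j x, 0 < x ->
  (forall y, 0 < y -> Derive_n (fun t => c * stieltjes_sum lam k p t) j y =
     c * (-1) ^ j * rising p j * stieltjes_sum lam k (p + j) y) ->
  is_derive (Derive_n (fun t => c * stieltjes_sum lam k p t) j) x
    (c * (-1) ^ S j * rising p (S j) * stieltjes_sum lam k (p + S j) x)).
{ intros i t Ht E.
  apply (is_derive_ext_pos (fun t => c * (-1) ^ i * rising p i * stieltjes_sum lam k (p + i) t));
    [intros y Hy; symmetry; now apply E|exact Ht|].
  replace (c * (-1) ^ S i * rising p (S i) * stieltjes_sum lam k (p + S i) t) with
    (- (c * (-1) ^ i * rising p i) * INR (p + i) * stieltjes_sum lam k (S (p + i)) t).
  - apply D; [lia|exact Ht].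
  - rewrite Nat.add_succ_r; simpl; ring. }
assert (val : forall j x, 0 < x -> Derive_n (fun t => c * stieltjes_sum lam k p t) j x =
    c * (-1) ^ j * rising p j * stieltjes_sum lam k (p + j) x).
{ induction j0 as [|i IH]; intros t Ht.
  - rewrite Nat.add_0_r; simpl; ring.
  - apply is_derive_unique, step; assumption. }
intros Hx; split; [apply step; [exact Hx|intros; now apply val]|now apply val].
Qed.

Lemma smooth_pos_stieltjes_sum lam c k p :
  (forall n, 0 < lam n) -> ex_series (fun n => / lam n) -> (k < p)%nat ->
  smooth_pos (fun t => c * stieltjes_sum lam k p t).
Proof.
intros Hl Hs Hkp [|j] x Hx; [exact I|].
eexists; now apply Derive_n_stieltjes_sum.
Qed.

Lemma rising_1 m : rising 1 m = INR (fact m).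
Proof.
induction m as [|m IH]; [reflexivity|].
change (rising 1 m * INR (1 + m) = INR (fact (S m))).
rewrite IH, fact_simpl, mult_INR, Rmult_comm; reflexivity.
Qed.

(** Writing [t^(k+1+m) h = t * (t^(k+m) h)] and applying [Derive_n_mult_id]
    turns the formula for [k] into the one for [k + 1]; the two resulting sums
    combine by [stieltjes_sum_shift]. *)
Lemma Derive_n_pow_mult_stieltjes lam c k m x :
  (forall n, 0 < lam n) -> ex_series (fun n => / lam n) -> 0 < x ->
  Derive_n (fun t => t ^ (k + m) * (c * INR (fact m) * stieltjes_sum lam 0 (S m) t)) k x
  = c * x ^ m * INR (fact (k + m)) * stieltjes_sum lam k (S (k + m)) x.
Proof.
intros Hl Hs; revert x; induction k as [|k IH]; intros x Hx; [simpl; ring|].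
set (h := fun t => c * INR (fact m) * stieltjes_sum lam 0 (S m) t) in *.
assert (Sh : smooth_pos h) by (apply smooth_pos_stieltjes_sum; auto; lia).
rewrite (Derive_n_ext_pos _ (fun t => t * (t ^ (k + m) * h t))); [|intros; unfold h; simpl; ring|exact Hx].
transitivity (Derive (Derive_n (fun t => t * (t ^ (k + m) * h t)) k) x); [reflexivity|].
rewrite (is_derive_unique _ _ _ (Derive_n_mult_id _ k x (smooth_pos_mult_pow h (k + m) Sh) Hx)).
change (Derive_n (fun t => t ^ (k + m) * h t) (S k) x)
  with (Derive (Derive_n (fun t => t ^ (k + m) * h t) k) x).
assert (D : is_derive (Derive_n (fun t => t ^ (k + m) * h t) k) x
  (INR m * x ^ pred m * (c * INR (fact (k + m)) * stieltjes_sum lam k (S (k + m)) x)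
   + x ^ m * (c * INR (fact (k + m)) * (- INR (S (k + m)) * stieltjes_sum lam k (S (S (k + m))) x)))).
{ apply (is_derive_ext_pos (fun t => t ^ m * (c * INR (fact (k + m)) * stieltjes_sum lam k (S (k + m)) t)));
    [intros t Ht; unfold h; rewrite IH by exact Ht; ring|exact Hx|].
  assert (Dp := is_derive_pow (fun t => t) m x 1 (is_derive_id (K := R_AbsRing) x)).
  assert (Ds := is_derive_scal _ x (c * INR (fact (k + m))) _
     (is_derive_stieltjes_sum lam k (S (k + m)) x Hl Hs ltac:(lia) Hx)).
  assert (Dm := is_derive_mult _ _ x _ _ Dp Ds Rmult_comm).
  match type of Dm with is_derive _ _ ?l => match goal with |- is_derive _ _ ?l' =>
    replace l' with l end end; [exact Dm|].
  unfold plus, mult; simpl plus; simpl mult.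
  change (INR m * 1 * x ^ pred m * (c * INR (fact (k + m)) * stieltjes_sum lam k (S (k + m)) x)
    + x ^ m * (c * INR (fact (k + m)) * (- INR (S (k + m)) * stieltjes_sum lam k (S (S (k + m))) x))
   = INR m * x ^ pred m * (c * INR (fact (k + m)) * stieltjes_sum lam k (S (k + m)) x)
   + x ^ m * (c * INR (fact (k + m)) * (- INR (S (k + m)) * stieltjes_sum lam k (S (S (k + m))) x))).
  ring. }
rewrite (is_derive_unique _ _ _ D); unfold h; rewrite IH by exact Hx.
change (S k + m)%nat with (S (k + m)).
rewrite stieltjes_sum_shift by (auto; lia).
rewrite fact_simpl, mult_INR.
assert (Em : INR m * x ^ pred m * x = INR m * x ^ m) by (destruct m; simpl; ring).
replace (INR (S (k + m))) with (INR (S k) + INR m) by (rewrite <- plus_INR; reflexivity).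
set (F1 := INR (fact (k + m))); set (S1 := stieltjes_sum lam k (S (k + m)) x).
set (S2 := stieltjes_sum lam k (S (S (k + m))) x).
transitivity (INR m * x ^ pred m * x * (c * F1 * S1)
  - x * x ^ m * c * F1 * (INR (S k) + INR m) * S2 + INR (S k) * c * x ^ m * F1 * S1); [ring|].
rewrite Em; ring.
Qed.

Lemma Derive_n_log_derivative f lam m x :
  (forall n, 0 < lam n) -> ex_series (fun n => / lam n) ->
  (forall y, 0 < y -> log_derivative (on_reals f) y = stieltjes_sum lam 0 1 y) -> 0 < x ->
  Derive_n (log_derivative (on_reals f)) m x =
    (-1) ^ m * INR (fact m) * stieltjes_sum lam 0 (S m) x.
Proof.
intros Hl Hs Hld Hx.
rewrite (Derive_n_ext_pos _ (fun t => 1 * stieltjes_sum lam 0 1 t));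
  [|intros y Hy; rewrite Hld by exact Hy; ring|exact Hx].
destruct (Derive_n_stieltjes_sum lam 1 0 1 m x Hl Hs ltac:(lia) Hx) as [_ E].
rewrite E, rising_1; change (1 + m)%nat with (S m); ring.
Qed.

Lemma G_closed_form f lam k m x :
  (forall n, 0 < lam n) -> ex_series (fun n => / lam n) ->
  (forall y, 0 < y -> log_derivative (on_reals f) y = stieltjes_sum lam 0 1 y) -> 0 < x ->
  G f m k x = INR (fact (k + m)) * stieltjes_sum lam k (S (k + m)) x.
Proof.
intros Hl Hs Hld Hx; unfold G.
rewrite (Derive_n_ext_pos _
  (fun t => t ^ (k + m) * ((-1) ^ m * INR (fact m) * stieltjes_sum lam 0 (S m) t)));
  [|intros y Hy; rewrite (Derive_n_log_derivative f lam) by assumption; ring|exact Hx].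
rewrite Derive_n_pow_mult_stieltjes by assumption.
assert (E : (- (1 / x)) ^ m * ((-1) ^ m * x ^ m) = 1).
{ rewrite <- !Rpow_mult_distr.
  replace (- (1 / x) * (-1 * x)) with 1 by (field; lra); apply pow1. }
set (S1 := stieltjes_sum lam k (S (k + m)) x).
transitivity ((- (1 / x)) ^ m * ((-1) ^ m * x ^ m) * (INR (fact (k + m)) * S1)); [ring|].
rewrite E; ring.
Qed.

Theorem conclusion_of_log_derivative f lam :
  (forall n, 0 < lam n) -> ex_series (fun n => / lam n) ->
  (forall y, 0 < y -> log_derivative (on_reals f) y = stieltjes_sum lam 0 1 y) ->
  (forall k m : nat, completely_monotonic (G f m k)) /\
  (forall m : nat,
     (forall x : R, 0 < x ->
        G f m 0 x = (-1) ^ m * Derive_n (log_derivative (on_reals f)) m x) /\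
     (forall (k : nat) (x : R), (1 <= k)%nat -> 0 < x ->
        G f m k x =
        INR (m + k) * G f m (k - 1) x + x * Derive (G f m (k - 1)) x)).
Proof.
intros Hl Hs Hld.
assert (HG := fun k m x Hx => G_closed_form f lam k m x Hl Hs Hld Hx).
split; [|intros m; split].
- intros k m j x Hx.
  assert (HG' : forall y, 0 < y ->
    INR (fact (k + m)) * stieltjes_sum lam k (S (k + m)) y = G f m k y)
    by (intros; symmetry; now apply HG).
  split.
  + apply (ex_derive_n_ext_pos _ _ j x HG' Hx).
    apply smooth_pos_stieltjes_sum; auto; lia.
  + rewrite <- (Derive_n_ext_pos _ _ j x HG' Hx).
    destruct (Derive_n_stieltjes_sum lam (INR (fact (k + m))) k (S (k + m)) j x Hl Hs ltac:(lia) Hx)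
      as [_ E].
    rewrite E.
    assert (Sg : (-1) ^ j * (-1) ^ j = 1).
    { rewrite <- Rpow_mult_distr; replace (-1 * -1) with 1 by ring; apply pow1. }
    match goal with |- 0 <= ?l => replace l with
      ((-1) ^ j * (-1) ^ j * (INR (fact (k + m)) * rising (S (k + m)) j *
        stieltjes_sum lam k (S (k + m) + j) x)) by ring end.
    rewrite Sg, Rmult_1_l; apply Rmult_le_pos.
    * apply Rmult_le_pos; [apply pos_INR|apply rising_nonneg].
    * apply stieltjes_sum_pos; auto; lia.
- intros x Hx; rewrite HG, (Derive_n_log_derivative f lam) by assumption.
  assert (Sg : (-1) ^ m * (-1) ^ m = 1).
  { rewrite <- Rpow_mult_distr; replace (-1 * -1) with 1 by ring; apply pow1. }
  rewrite <- !Rmult_assoc, Sg; change (0 + m)%nat with m; ring.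
- intros [|k] x Hk Hx; [lia|].
  replace (S k - 1)%nat with k by lia.
  rewrite !HG by exact Hx.
  assert (D : is_derive (G f m k) x
    (INR (fact (k + m)) * (- INR (S (k + m)) * stieltjes_sum lam k (S (S (k + m))) x))).
  { apply (is_derive_ext_pos (fun y => INR (fact (k + m)) * stieltjes_sum lam k (S (k + m)) y));
      [intros; symmetry; now apply HG|exact Hx|].
    apply (is_derive_scal (stieltjes_sum lam k (S (k + m)))).
    apply is_derive_stieltjes_sum; auto; lia. }
  rewrite (is_derive_unique _ _ _ D).
  change (S k + m)%nat with (S (k + m)).
  rewrite stieltjes_sum_shift by (auto; lia).
  rewrite fact_simpl, mult_INR.
  replace (m + S k)%nat with (S (k + m)) by lia; ring.
Qed.


(** * Growth, realness and the theorem *)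

(** The supremum defining [max_modulus] is finite because an entire function
    is bounded on discs. *)
Lemma max_modulus_ge b h z r :
  entire_series b h -> Cmod z <= r -> Cmod (h z) <= max_modulus h r.
Proof.
intros H Hz; pose proof (Cmod_ge_0 z).
destruct (entire_bounded_on_disc b h r H ltac:(lra)) as [B HB].
unfold max_modulus.
set (E := fun y => exists z : C, Cmod z <= r /\ y = Cmod (h z)).
destruct (Lub_Rbar_correct E) as [Hub Hle].
assert (Hin := Hub (Cmod (h z)) (ex_intro _ z (conj Hz eq_refl))).
assert (HleB := Hle (Finite B) ltac:(intros y [w [Hw ->]]; now apply HB)).
destruct (Lub_Rbar E); simpl in *; [exact Hin|contradiction|contradiction].
Qed.

(** Some tail supremum lies below 1 already, since the limit superior is the
    infimum of these suprema. *)
Lemma order_lt_1_bound f :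
  Rbar_lt (order f) (Finite 1) ->
  exists s r0, s < 1 /\ forall r, r0 < r -> ln (ln (max_modulus f r)) / ln r <= s.
Proof.
intros H; unfold order, limsup_infty in H.
set (q := fun r => ln (ln (max_modulus f r)) / ln r) in H.
set (E := fun s => exists r0 : R, s = Lub_Rbar (fun y => exists r : R, r0 < r /\ y = q r)) in H.
assert (Hex : exists s, E s /\ Rbar_lt s 1).
{ apply NNPP; intros Hno.
  assert (Hle : Rbar_le 1 (Rbar_glb E)).
  { unfold Rbar_glb; destruct (Rbar_ex_glb E) as [gl [Hlow Hglb]]; simpl.
    apply (Hglb (Finite 1)); intros s Hs; apply Rbar_not_lt_le; intros Hlt; apply Hno; now exists s. }
  exact (Rbar_lt_not_le _ _ H Hle). }
destruct Hex as [s [[r0 ->] Hlt]].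
set (A := fun y => exists r : R, r0 < r /\ y = q r) in *.
destruct (Lub_Rbar_correct A) as [Hub _].
assert (Hin : forall r, r0 < r -> Rbar_le (q r) (Lub_Rbar A)).
{ intros r Hr; apply Hub; now exists r. }
destruct (Lub_Rbar A) as [s| |]; simpl in Hlt.
- exists s, r0; split; [exact Hlt|exact Hin].
- contradiction.
- exfalso; exact (Hin (r0 + 1) ltac:(lra)).
Qed.

(** For some [s < 1] one has [ln M(R) <= R^s] for large [R], and [R^s =
    o(R)]. *)
Lemma subexponential_of_order a f :
  entire_series a f -> a 0%nat <> RtoC 0 -> Rbar_lt (order f) (Finite 1) ->
  subexponential (fun z => / a 0%nat * f z)%C.
Proof.
intros Hf Ha0 Hord eps He.
destruct (order_lt_1_bound f Hord) as [s [r0 [Hs Hr0]]].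
assert (Pa := proj1 (Cmod_gt_0 _) Ha0).
set (lna := Rabs (ln (Cmod (a 0%nat)))).
(* The radius beyond which [R^(s-1) <= eps / 2]. *)
set (R1 := exp (ln (eps / 2) / (s - 1))).
exists (Rmax (Rmax 2 (r0 + 1)) (Rmax R1 (2 * lna / eps))); intros R HR.
assert (M1 := Rmax_l (Rmax 2 (r0 + 1)) (Rmax R1 (2 * lna / eps))).
assert (M2 := Rmax_r (Rmax 2 (r0 + 1)) (Rmax R1 (2 * lna / eps))).
assert (M3 := Rmax_l 2 (r0 + 1)); assert (M4 := Rmax_r 2 (r0 + 1)).
assert (M5 := Rmax_l R1 (2 * lna / eps)); assert (M6 := Rmax_r R1 (2 * lna / eps)).
set (M := max_modulus f R).
assert (PM : 0 < M).
{ apply Rlt_le_trans with (Cmod (f (RtoC 0))).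
  - rewrite (entire_at_0 a f Hf); exact Pa.
  - apply (max_modulus_ge a f _ _ Hf); rewrite Cmod_0; lra. }
exists (/ Cmod (a 0%nat) * M); split.
- intros w Hw; rewrite Cmod_mult, Cmod_inv by exact Ha0.
  apply Rmult_le_compat_l; [now apply Rlt_le, Rinv_0_lt_compat|].
  apply (max_modulus_ge a f _ _ Hf); lra.
- rewrite ln_mult, ln_Rinv by (try apply Rinv_0_lt_compat; assumption).
  assert (PlnR : 0 < ln R) by (rewrite <- ln_1; apply ln_increasing; lra).
  (* The outer logarithm carries information only when [ln M] is positive. *)
  assert (HlnM : ln M <= exp (s * ln R)).
  { destruct (Rle_lt_dec (ln M) 0) as [Hneg|Hpos]; [pose proof (exp_pos (s * ln R)); lra|].
    rewrite <- (exp_ln (ln M)) by exact Hpos.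
    assert (Q := Hr0 R ltac:(lra)); fold M in Q.
    assert (Q' : ln (ln M) <= s * ln R).
    { apply Rmult_le_reg_r with (/ ln R); [now apply Rinv_0_lt_compat|].
      replace (s * ln R * / ln R) with s by (field; lra); exact Q. }
    destruct Q' as [Q'|Q']; [left; now apply exp_increasing|rewrite Q'; lra]. }
  assert (HR1 : exp (s * ln R) <= eps / 2 * R).
  { replace (s * ln R) with ((s - 1) * ln R + ln R) by ring.
    rewrite exp_plus, exp_ln by lra; apply Rmult_le_compat_r; [lra|].
    assert (L : ln (eps / 2) / (s - 1) <= ln R).
    { rewrite <- (ln_exp (ln (eps / 2) / (s - 1))); apply ln_le; [apply exp_pos|unfold R1 in *; lra]. }
    assert (Q : (s - 1) * ln R <= ln (eps / 2)).
    { replace (ln (eps / 2)) with ((s - 1) * (ln (eps / 2) / (s - 1))) by (field; lra).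
      apply Rmult_le_compat_neg_l; [lra|exact L]. }
    rewrite <- (exp_ln (eps / 2)) by lra.
    destruct Q as [Q|Q]; [left; now apply exp_increasing|rewrite Q; lra]. }
  assert (Hlna : - ln (Cmod (a 0%nat)) <= lna).
  { unfold lna; rewrite <- Rabs_Ropp; apply Rle_abs. }
  assert (lna <= eps / 2 * R).
  { replace lna with (eps / 2 * (2 * lna / eps)) by (field; lra).
    apply Rmult_le_compat_l; lra. }
  lra.
Qed.

Lemma lists_roots_scal f mu (c : C) :
  c <> RtoC 0 -> lists_roots f mu -> lists_roots (fun z => c * f z)%C mu.
Proof.
intros Hc H z; destruct (H z) as [l [Hl [Hin [g [[b Hg] [Hgz E]]]]]].
exists l; split; [exact Hl|split; [exact Hin|]].
exists (fun w => c * g w)%C; split; [|split].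
- eexists; apply entire_scal, Hg.
- now apply Cmult_neq_0.
- intros w; rewrite E; ring.
Qed.

Lemma RtoC_neq_0 x : x <> 0 -> RtoC x <> RtoC 0.
Proof. intros H E; apply H; exact (f_equal fst E). Qed.

(** The series on the positive axis is a real series of positive terms. *)
Lemma positive_coefficients_real (g : nat -> R) F x :
  entire_series (fun n => RtoC (g n)) F -> (forall n, 0 < g n) -> 0 < x ->
  exists s, 0 < s /\ F (RtoC x) = RtoC s.
Proof.
intros H Hg Hx.
destruct (entire_abs _ _ x H ltac:(lra)) as [s Hs].
assert (Hs' : is_series (fun k => g k * x ^ k) s).
{ eapply is_series_ext; [|exact Hs]; intros k; simpl.
  rewrite Cmod_R, Rabs_pos_eq; [reflexivity|apply Rlt_le, Hg]. }
exists s; split.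
- apply Rlt_le_trans with (g 0%nat); [apply Hg|].
  assert (T := is_lim_seq_incr_compare (rsum (fun k => g k * x ^ k)) s Hs'
    ltac:(intros n; rewrite rsum_S; assert (0 < g (S n) * x ^ S n)
      by (apply Rmult_lt_0_compat; [apply Hg|now apply pow_lt]); lra) 0%nat).
  rewrite rsum_0 in T; simpl in T; lra.
- rewrite entire_series_iff in H; apply (Cseries_unique _ _ _ (H (RtoC x))).
  apply Cseries_iff; intros eps He.
  destruct (proj1 (Rseries_iff _ _) Hs' eps He) as [N HN]; exists N; intros n Hn.
  specialize (HN n Hn).
  replace (csum (fun k => RtoC (g k) * RtoC x ^ k)%C n) with (RtoC (rsum (fun k => g k * x ^ k) n)).
  + rewrite <- RtoC_minus, Cmod_R; exact HN.
  + clear; induction n as [|n IH].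
    * rewrite csum_0, rsum_0, RtoC_mult, RtoC_pow; reflexivity.
    * rewrite csum_S, rsum_S, RtoC_plus, RtoC_mult, RtoC_pow, IH; reflexivity.
Qed.

Theorem theorem1 (a : nat -> C) (f : C -> C) (lam : nat -> R)
    (f_entire : entire_series a f)
    (a_pos : forall n : nat,
        Im (Cmult (a 0%nat) (a n)) = 0 /\ 0 < Re (Cmult (a 0%nat) (a n)))
    (order_ge0 : Rbar_le (Finite 0) (order f))
    (order_lt1 : Rbar_lt (order f) (Finite 1))
    (lam_pos : forall n : nat, 0 < lam n)
    (f_roots : lists_roots f (fun n => RtoC (- lam n))) :
  (forall k m : nat, completely_monotonic (G f m k)) /\
  (forall m : nat,
     (forall x : R, 0 < x ->
        G f m 0 x = (-1) ^ m * Derive_n (log_derivative (on_reals f)) m x) /\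
     (forall (k : nat) (x : R), (1 <= k)%nat -> 0 < x ->
        G f m k x =
        INR (m + k) * G f m (k - 1) x + x * Derive (G f m (k - 1)) x)).
Proof.
assert (Ha0 : exists r, r <> 0 /\ a 0%nat = RtoC r).
{ destruct (a_pos 0%nat) as [H1 H2]; destruct (a 0%nat) as [u v]; simpl in H1, H2.
  assert (Hu : u <> 0) by (intros ->; nra).
  assert (Hv : v = 0) by (apply (Rmult_eq_reg_l u); [lra|exact Hu]).
  exists u; split; [exact Hu|rewrite Hv; reflexivity]. }
destruct Ha0 as [r [Hr Ha0]].
assert (Har : forall n, exists g, 0 < g /\ (/ a 0%nat * a n)%C = RtoC g).
{ intros n; destruct (a_pos n) as [H1 H2]; rewrite Ha0 in *.
  destruct (a n) as [u v]; simpl in H1, H2.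
  assert (Hv : v = 0) by (apply (Rmult_eq_reg_l r); [lra|exact Hr]).
  exists (u / r); split.
  - apply Rmult_lt_reg_r with (r * r); [nra|].
    replace (u / r * (r * r)) with (r * u) by (field; exact Hr); lra.
  - rewrite <- RtoC_inv by exact Hr; subst v.
    unfold Cmult, RtoC; simpl; f_equal; field; exact Hr. }
destruct (functional_choice _ Har) as [g Hg].
set (F := fun z => (/ a 0%nat * f z)%C).
assert (Ha0' : a 0%nat <> RtoC 0) by (rewrite Ha0; now apply RtoC_neq_0).
assert (HF : entire_series (fun n => RtoC (g n)) F).
{ assert (T := entire_scal (/ a 0%nat)%C a f f_entire).
  rewrite entire_series_iff in T |- *; intros z.
  eapply is_series_ext; [|exact (T z)]; intros n; simpl.
  now rewrite (proj2 (Hg n)). }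
assert (c0 : RtoC (g 0%nat) = RtoC 1) by (rewrite <- (proj2 (Hg 0%nat)); now apply Cinv_l).
assert (Hroots : lists_roots F (fun n => RtoC (- lam n))).
{ apply lists_roots_scal; [|exact f_roots].
  intros Z; apply C1_nz; rewrite <- (Cinv_r _ Ha0'), Z; ring. }
assert (Hsub := subexponential_of_order a f f_entire Ha0' order_lt1 : subexponential F).
assert (Hprod := fun x Hx => hadamard_product_log _ F lam x HF c0 lam_pos Hroots Hsub Hx).
assert (Hlam : ex_series (fun n => / lam n)).
{ apply ex_series_inv_of_log; [exact lam_pos|].
  eexists; apply (Hprod 1 Rlt_0_1). }
assert (Hon : forall x, 0 < x ->
  on_reals f x = r * exp (Series (fun n => ln (1 + x / lam n)))).
{ intros x Hx.
  destruct (positive_coefficients_real g F x HF (fun n => proj1 (Hg n)) Hx) as [s [Hs E]].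
  rewrite (is_series_unique _ _ (Hprod x Hx)), E, Cmod_R, Rabs_pos_eq, exp_ln by lra.
  unfold on_reals.
  replace (f (RtoC x)) with (a 0%nat * F (RtoC x))%C by (unfold F; field; exact Ha0').
  rewrite E, Ha0; simpl; ring. }
apply (conclusion_of_log_derivative f lam lam_pos Hlam).
intros x Hx; unfold log_derivative.
assert (D : is_derive (on_reals f) x
  (r * (stieltjes_sum lam 0 1 x * exp (Series (fun n => ln (1 + x / lam n)))))).
{ apply (is_derive_ext_pos (fun y => r * exp (Series (fun n => ln (1 + y / lam n)))));
    [intros; symmetry; now apply Hon|exact Hx|].
  apply (is_derive_scal (fun y => exp (Series (fun n => ln (1 + y / lam n))))).
  apply (is_derive_comp exp (fun y => Series (fun n => ln (1 + y / lam n)))).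
  - apply is_derive_exp.
  - apply is_derive_log_product; auto; intros y Hy; eexists; apply (Hprod y Hy). }
rewrite (is_derive_unique _ _ _ D), Hon by exact Hx.
pose proof (exp_pos (Series (fun n => ln (1 + x / lam n)))); field; lra.
Qed.
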